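(* Let $f=\sum_{s\ge0}a_s\phi_r^s$ be a non-zero element of $K[x]_{\mu\text{-att}}$ ($\deg a_s<m_r$), let $R_r(f)=c_0+c_1y+\cdots+c_dy^d\in\kappa_r[y]$, and for each $j$ with $c_j\neq0$ put $s_j=s_r(f)+je_r$. Then, for each such $j$: if $r=0$, $a_{s_j}\in K^*$, $v(a_{s_j})\in\Gamma_{-1}$ and $c_j$ is the residue class in $k=\kappa_0$ of $a_{s_j}/\pi_0^{v(a_{s_j})}$; if $r>0$, $a_{s_j}\in K[x]_{\mu_{r-1}\text{-att}}$ and $$c_j=\epsilon_{r-1}(a_{s_j})\,R_{r-1}(a_{s_j})(z_{r-1}).$$
   Context: Let $(K,v)$ be a valued field with non-trivial value group $\Gamma$, residue field $k$, $\Gamma_{\mathbb Q}=\Gamma\otimes\mathbb Q$. For a valuation $\mu$ on $K[x]$: graded algebra $\mathcal G_\mu=\bigoplus_\alpha\{\mu\ge\alpha\}/\{\mu>\alpha\}$, degree-zero part $\Delta_\mu$, initial form $H_\mu$ (multiplicative, extended to quotients); $h\mid_\mu g$ iff $H_\mu(h)\mid H_\mu(g)$. Key polynomial: monic $\phi$ with $H_\mu(\phi)\mathcal G_\mu$ non-zero prime and $\phi\nmid_\mu f$ for non-zero $f$ of smaller degree; $[\mu;\phi,\gamma](\sum a_s\phi^s)=\min(\mu(a_s)+s\gamma)$ for $\gamma>\mu(\phi)$; canonical map $\mathcal G_\mu\to\mathcal G_{\mu'}$ ($\mu\le\mu'$ in a chain): $H_\mu(f)\mapsto H_{\mu'}(f)$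 if $\mu(f)=\mu'(f)$, else $0$. MacLane chain $\mu_{-\infty}\xrightarrow{\phi_0,\gamma_0}\mu_0\to\cdots\xrightarrow{\phi_r,\gamma_r}\mu_r=\mu$: $\gamma_i\in\Gamma_{\mathbb Q}$, $\phi_0=x+a$, $\mu_0(\sum a_s\phi_0^s)=\min(v(a_s)+s\gamma_0)$, $\phi_i$ key polynomial for $\mu_{i-1}$, $\mu_i=[\mu_{i-1};\phi_i,\gamma_i]$, $\phi_{i+1}\nmid_{\mu_i}\phi_i$. $\mu_{-1}=v$, $\Gamma_{\mu_{-1}}=\Gamma$, $m_i=\deg\phi_i$, $e_i=(\Gamma_{\mu_i}:\Gamma_{\mu_{i-1}})$, $h_i=e_i\gamma_i$. $\kappa_0$ = image of $k$ in $\Delta_{\mu_0}$ (identified with $k$), $\kappa_i$ = image of $\Delta_{\mu_{i-1}}\to\Delta_{\mu_i}$; $k=\kappa_0\subset\cdots\subset\kappa_r$. Fix a finitely generated $\Gamma_{-1}\subseteq\Gamma$ with $h_i\in\Gamma_{-1}+\langle\gamma_0,\dots,\gamma_{i-1}\rangle$; $\Gamma_i=\langle\Gamma_{-1},\gamma_0,\dots,\gamma_i\rangle$. Bases: $\iota_{0,1},\dots,\iota_{0,n}$ of $\Gamma_{-1}$; recursively $\gamma_i=\sum_j(h_{i,j}/e_{i,j})\iota_{i,j}$ (coprime, $e_{i,j}>0$), $e'_{i,1}=d_{i,1}=1$, $e'_{i,j}=\prod_{t<j}e_{i,t}/\prod_{t<j}d_{i,t}$, $d_{i,j}=\gcd(e_{i,j},e'_{i,j})$,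 integers $\ell_{i,j}h_{i,j}e'_{i,j}+\ell'_{i,j}e_{i,j}=d_{i,j}$, $0\le\ell_{i,j}<e_{i,j}/d_{i,j}$, $(\iota_{i+1,\cdot})=(\iota_{i,\cdot})Q_i$, $Q_i$ lower triangular with diagonal $d_{i,j}/e_{i,j}$, $(m,j)$-entry $\ell_{i,j}e'_{i,j}h_{i,m}/e_{i,m}$. $\pi_{0,j}\in K^*$, $v(\pi_{0,j})=\iota_{0,j}$; $\pi_{i+1,j}=(\phi_i\pi_{i,1}^{-h_{i,1}/e_{i,1}}\cdots\pi_{i,j-1}^{-h_{i,j-1}/e_{i,j-1}})^{\ell_{i,j}e'_{i,j}}\pi_{i,j}^{\ell'_{i,j}}$; $\pi_i^\alpha=\prod_j\pi_{i,j}^{n_j}$ for $\alpha=\sum n_j\iota_{i,j}\in\Gamma_{i-1}$; $Y_i=\phi_i^{e_i}\pi_i^{-h_i}$; $p_i^\alpha=H_{\mu_i}(\pi_i^\alpha)$, $y_i=H_{\mu_i}(Y_i)$; $z_i\in\kappa_{i+1}^*$ the image of $y_i$ in $\mathcal G_{\mu_{i+1}}$ (and further in $\mathcal G_{\mu}$). $L'_i=\ell'_{i,1}\cdots\ell'_{i,n}$, $L_{i,j}=\ell_{i,j}\ell'_{i,j+1}\cdots\ell'_{i,n}$, $L_i$ the $\mathbb Q$-linear map on $\Gamma_{i-1}\otimes\mathbb Q$ with $L_i(\iota_{i,j})=L_{i,j}$. For $0\le i\le r$: for non-zero $g=\sum_sb_s\phi_i^s$ ($\deg b_s<m_i$), $N_i(g)$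 is the lower convex hull in $\mathbb Q\times\Gamma_{\mathbb Q}$ of $Q_s=(s,\mu_{i-1}(b_s))$, $b_s\ne0$; $S_{\gamma_i}(g)$ = its points minimizing $u+s\gamma_i$, left endpoint $(s_i(g),u_i(g))$, right endpoint abscissa $s'_i(g)$. $K[x]_{\mu_i\text{-att}}=\{0\}\cup\{g\ne0:\mu_i(g)\in\Gamma_i\}$; for non-zero $g$ in it, with $d=(s'_i(g)-s_i(g))/e_i$, $t_j=s_i(g)+je_i$: $R_i(g)=\sum_{j=0}^dc_jy^j\in\kappa_i[y]$, $c_j=p_i^{-\mu_{i-1}(b_{t_j})}H_{\mu_i}(b_{t_j})$ if $Q_{t_j}$ lies on $N_i(g)$, else $0$. For $0\le i<r$ and non-zero $a\in K[x]_{\mu_i\text{-att}}$, define $\epsilon_i(a)=z_i^{\,L'_i s_i(a)-L_i(u_i(a))}\in\kappa_{i+1}^*$. *)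

(* Defs.v *)
From HB Require Import structures.
From mathcomp Require Import all_boot all_order all_algebra.
From Stdlib Require Import ClassicalEpsilon.
Set Implicit Arguments. Unset Strict Implicit. Unset Printing Implicit Defensive.
Import GRing.Theory Num.Theory.
Local Open Scope ring_scope.

(* Raw data of a valued field and of a MacLane chain.
   G plays the role of Gamma_Q (a Q-vector space with an order [gle]);
   valuations take values in [option G], [None] being +infinity. *)
Record MLdata (K : fieldType) (G : lmodType rat) := MLData {
  gle  : rel G;
  vv  : K -> option G;
  len  : nat;
  phi  : nat -> {poly K};
  gam  : nat -> G;
  rk   : nat;                   (* n = rank of Gamma_{-1} *)
  iota0 : 'I_rk -> G;           (* basis iota_{0,1..n} of Gamma_{-1} *)
  pi0  : 'I_rk -> K             (* pi_{0,j}, v(pi_{0,j}) = iota_{0,j} *)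
}.

Section MacLane.
Variables (K : fieldType) (G : lmodType rat) (D : MLdata K G).

Local Notation gle := (gle D).
Local Notation vv := (vv D).
Local Notation phi := (phi D).
Local Notation gam := (gam D).
Local Notation rk := (rk D).
Local Notation iota0 := (@iota0 _ _ D).
Local Notation pi0 := (@pi0 _ _ D).

Definition vle (a b : option G) : bool :=
  match a, b with
  | _, None => true
  | None, Some _ => false
  | Some x, Some y => gle x y
  end.
Definition vlt (a b : option G) : bool := vle a b && (a != b).
Definition vadd (a b : option G) : option G :=
  match a, b with Some x, Some y => Some (x + y) | _, _ => None end.
Definition vmin (a b : option G) : option G := if vle a b then a else b.
Definition vminl (s : seq (option G)) : option G := foldr vmin None s.

Definition value_group (m : {poly K} -> option G) : G -> Prop :=
  fun g => exists f, m f = Some g.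
Definition Gamma : G -> Prop := fun g => exists c : K, vv c = Some g.

Definition is_index (A B : G -> Prop) (e : nat) : Prop :=
  exists t : 'I_e -> G, (forall k, A (t k)) /\
    (forall x, A x -> exists! k, B (x - t k)).
Definition gindex (A B : G -> Prop) : nat := epsilon (inhabits 0%N) (is_index A B).

Definition coefx (p f : {poly K}) (s : nat) : {poly K} := (f %/ p ^+ s) %% p.

(* muR 0 = mu_{-1} = v (on constants), muR i.+1 = mu_i = [mu_{i-1}; phi_i, gamma_i],
   mu_0 being given by the formula with phi_0 and gamma_0. *)
Fixpoint muR (i : nat) (f : {poly K}) : option G :=
  match i with
  | 0 => vv f`_0
  | i'.+1 => vminl [seq vadd (muR i' (coefx (phi i') f s)) (Some (gam i' *+ s))
                   | s <- iota 0 (size f)]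
  end.
Definition mu (i : nat) := muR i.+1.

Definition eidx (i : nat) : nat := gindex (value_group (muR i.+1)) (value_group (muR i)).
Definition hval (i : nat) : G := gam i *+ eidx i.

(* Gamma_{k-1} = < Gamma_{-1}, gamma_0, ..., gamma_{k-1} >  (so Gamma_i = GammaS i.+1) *)
Definition GammaS (k : nat) : G -> Prop := fun g =>
  exists (c : 'I_rk -> int) (c' : nat -> int),
    g = \sum_(j < rk) iota0 j *~ c j + \sum_(t < k) gam t *~ c' t.

(* h |_mu g  iff  H_mu(h) divides H_mu(g) in G_mu *)
Definition mu_dvd (m : {poly K} -> option G) (h g : {poly K}) : Prop :=
  g = 0 \/ exists q : {poly K}, vlt (m g) (m (g - h * q)).

Definition key_poly (m : {poly K} -> option G) (p : {poly K}) : Prop :=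
  [/\ p \is monic,
      ~ mu_dvd m p 1,
      (forall f g : {poly K}, mu_dvd m p (f * g) -> mu_dvd m p f \/ mu_dvd m p g)
    & (forall f : {poly K}, f != 0 -> (size f < size p)%N -> ~ mu_dvd m p f)].

(* ---------- formal quotients (elements of K(x)) ---------- *)
Definition fq := ({poly K} * {poly K})%type.
Definition fq_poly (p : {poly K}) : fq := (p, 1).
Definition fq_const (c : K) : fq := (c%:P, 1).
Definition fq0 : fq := (0, 1).
Definition fq1 : fq := (1, 1).
Definition fqmul (F1 F2 : fq) : fq := (F1.1 * F2.1, F1.2 * F2.2).
Definition fqinv (F : fq) : fq := (F.2, F.1).
Definition fqsub (F1 F2 : fq) : fq := (F1.1 * F2.2 - F2.1 * F1.2, F1.2 * F2.2).
Definition fqexp (F : fq) (z : int) : fq :=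
  match z with
  | Posz n => (F.1 ^+ n, F.2 ^+ n)
  | Negz n => (F.2 ^+ n.+1, F.1 ^+ n.+1)
  end.
Definition fqval (m : {poly K} -> option G) (F : fq) : option G :=
  match m F.1, m F.2 with
  | Some a, Some b => Some (a - b)
  | _, _ => None
  end.
(* equality of the classes of F1, F2 in degree 0 of the graded algebra of m:
   H_m(F1) = H_m(F2) for elements of m-value 0, i.e. m(F1 - F2) > 0 *)
Definition deg0_eq (m : {poly K} -> option G) (F1 F2 : fq) : Prop :=
  vlt (Some 0) (fqval m (fqsub F1 F2)).

Definition coordG (b : 'I_rk -> G) (a : G) : 'I_rk -> rat :=
  epsilon (inhabits (fun _ => 0)) (fun q => a = \sum_(j < rk) q j *: b j).

Section Step.
(* data of one step: b = iota_{i,.}, g = gamma_i ; indices 0-based *)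
Variables (b : 'I_rk -> G) (g : G).
Definition qn (k : nat) : rat := if insub k is Some j then coordG b g j else 0.
Definition hN (k : nat) : int := numq (qn k).
Definition eN (k : nat) : nat := `|denq (qn k)|%N.
Fixpoint e'N (k : nat) : nat :=
  match k with
  | 0 => 1%N
  | k'.+1 => (e'N k' * (eN k' %/ gcdn (eN k') (e'N k')))%N
  end.
Definition dN (k : nat) : nat := gcdn (eN k) (e'N k).
(* l_{i,k}: the unique 0 <= l < e/d with l h e' = d  (mod e) *)
Definition lN (k : nat) : nat :=
  find (fun l : nat => ((eN k)%:Z %| (dN k)%:Z - l%:Z * hN k * (e'N k)%:Z)%Z)
       (iota 0 (eN k %/ dN k)).
Definition l'N (k : nat) : int :=
  (((dN k)%:Z - (lN k)%:Z * hN k * (e'N k)%:Z) %/ (eN k)%:Z)%Z.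
(* iota_{i+1,.} = iota_{i,.} Q_i *)
Definition nextb : 'I_rk -> G := fun j =>
  ((dN j)%:R / (eN j)%:R) *: b j
  + \sum_(m < rk | (j < m)%N)
      (((lN j * e'N j)%N)%:R * (hN m)%:~R / (eN m)%:R) *: b m.
(* pi_{i+1,j} = (phi_i pi_{i,1}^{-h_1/e_1} ... pi_{i,j-1}^{-h_{j-1}/e_{j-1}})^{l_j e'_j} pi_{i,j}^{l'_j} *)
Definition nextpi (p : {poly K}) (P : 'I_rk -> fq) : 'I_rk -> fq := fun j =>
  fqmul (fqexp (fq_poly p) (lN j * e'N j)%N)
    (fqmul (\big[fqmul/fq1]_(t < rk | (t < j)%N)
              fqexp (P t) (- hN t * (lN j)%:Z * (e'N j %/ eN t)%N%:Z))
           (fqexp (P j) (l'N j))).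
Definition Lp : int := \prod_(k < rk) l'N k.
Definition Lk (k : nat) : int := (lN k)%:Z * \prod_(k.+1 <= t < rk) l'N t.
Definition Lmap (a : G) : rat := \sum_(j < rk) coordG b a j * (Lk j)%:~R.
End Step.

Fixpoint basis (i : nat) : ('I_rk -> G) * ('I_rk -> fq) :=
  match i with
  | 0 => (iota0, fun j => fq_const (pi0 j))
  | i'.+1 => let (b, P) := basis i' in
             (nextb b (gam i'), nextpi b (gam i') (phi i') P)
  end.
Definition iotaB (i : nat) := (basis i).1.
Definition piB (i : nat) := (basis i).2.

(* pi_i^alpha, for alpha in Gamma_{i-1} *)
Definition piexp (i : nat) (a : G) : fq :=
  \big[fqmul/fq1]_(j < rk) fqexp (piB i j) (numq (coordG (iotaB i) a j)).
Definition pi0exp (a : G) : K :=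
  \prod_(j < rk) (pi0 j) ^ (numq (coordG (iota0) a j)).

Definition Yfq (i : nat) : fq :=
  fqmul (fq_poly (phi i ^+ eidx i)) (fqinv (piexp i (hval i))).

Definition att (i : nat) (f : {poly K}) : Prop :=
  f = 0 \/ exists g, mu i f = Some g /\ GammaS i.+1 g.

(* Q_s lies on S_{gamma_i}(f): u_s + s gamma_i = min = mu_i(f) *)
Definition onl (i : nat) (f : {poly K}) (s : nat) : bool :=
  vadd (muR i (coefx (phi i) f s)) (Some (gam i *+ s)) == mu i f.
Definition sI (i : nat) (f : {poly K}) : nat := find (onl i f) (iota 0 (size f)).
Definition s'I (i : nat) (f : {poly K}) : nat := \max_(s < size f | onl i f s) s.
Definition uI (i : nat) (f : {poly K}) : G := odflt 0 (muR i (coefx (phi i) f (sI i f))).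
Definition dR (i : nat) (f : {poly K}) : nat := ((s'I i f - sI i f) %/ eidx i)%N.
(* representative in K(x) of the coefficient c_j of R_i(f) *)
Definition Rcoef (i : nat) (f : {poly K}) (j : nat) : fq :=
  let t := (sI i f + j * eidx i)%N in
  let bt := coefx (phi i) f t in
  if onl i f t then fqmul (fq_poly bt) (fqinv (piexp i (odflt 0 (muR i bt))))
  else fq0.
(* exponent  L'_i s_i(a) - L_i(u_i(a))  of epsilon_i(a) = z_i^(...) *)
Definition epsexp (i : nat) (a : {poly K}) : int :=
  numq ((Lp (iotaB i) (gam i))%:~R * (sI i a)%:R - Lmap (iotaB i) (gam i) (uI i a)).

Definition MLchain_ok : Prop :=
  [/\ reflexive gle, transitive gle, antisymmetric gle, total gle
    & forall x y z, gle x y -> gle (x + z) (y + z)] /\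
  (* v is a valuation with non-trivial value group Gamma, and G = Gamma (x) Q *)
  [/\ (forall c, vv c = None <-> c = 0),
      (forall c d, vv (c * d) = vadd (vv c) (vv d)),
      (forall c d, vle (vmin (vv c) (vv d)) (vv (c + d))),
      (exists g, Gamma g /\ g != 0)
    & (forall g : G, exists n : nat, (0 < n)%N /\ Gamma (g *+ n))] /\
  [/\ exists a : K, phi 0 = 'X + a%:P,
      (forall i, (0 < i <= len D)%N ->
          key_poly (muR i) (phi i) /\ vlt (muR i (phi i)) (Some (gam i)))
    & (forall i, (i < len D)%N -> ~ mu_dvd (mu i) (phi i.+1) (phi i))] /\
  [/\ (forall j, Gamma (iota0 j)),
      (forall c : 'I_rk -> int, \sum_(j < rk) iota0 j *~ c j = 0 -> forall j, c j = 0),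
      (forall i, (i <= len D)%N -> GammaS i (hval i))
    & (forall j, vv (pi0 j) = Some (iota0 j))].

End MacLane.

(* Main.v *)
(** The valuations [mu_i] are handled one augmentation at a time: [mu_i] is
multiplicative because reduction modulo [phi_i] is multiplicative on initial forms,
and every polynomial not [mu_(i-1)]-divisible by [phi_i] becomes a unit of the graded
algebra of [mu_i]. In particular [phi_0, ..., phi_(r-1)], hence all [pi_(r,j)] and
[Y_(r-1)], are units of the graded algebra of [mu_r].

For a coefficient [a] of [f] on the slope and [i = r-1], the terms of the
[phi_i]-expansion of [a] that lie on its slope are those of index [s + k e_i], and
modulo terms of larger value [a] is the sum of [b_t phi_i^t] over them. The bases
change by unimodular steps: with [B_0 = phi_i] and
[B_(k+1) = B_k^(e_k/d_k) pi_k^(-h_k e'_k/d_k)] one has [B_n = Y_i],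
[B_k = pi_(i+1,k)^(h_k e'_k/d_k) B_(k+1)^(l'_k)] and
[pi_k = pi_(i+1,k)^(e_k/d_k) B_(k+1)^(-l_k)]. Unwinding these relations gives
[phi_i^s pi_i^u = Y_i^(L'_i s - L_i(u)) pi_(i+1)^(s gamma_i + u)] in [K(x)], and dividing
the sum above by [pi_r^(mu_i(a))] yields the formula. *)

Require Import Defs.
From mathcomp Require Import all_boot all_order all_algebra.
From mathcomp Require Import fraction generic_quotient.
From mathcomp Require Import ring zify.
From Stdlib Require Import ClassicalEpsilon.
Import GRing.Theory Num.Theory.
Set Implicit Arguments. Unset Strict Implicit. Unset Printing Implicit Defensive.
Local Open Scope ring_scope.

(** * Values and valuations *)

(** Equality of classes in degree zero is proved in the fraction field of [{poly K}]: each valuation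
    extends to it, and equality becomes [near], congruence modulo elements of positive value. The
    monomial identity is then an exact identity in a field, with negative exponents allowed. The
    obstacle is that [z_(r-1)] and the coefficients of [R_(r-1)] are images under the map between
    two graded algebras, while polynomials representing them at level [r-1] are required. They exist
    because the denominators are monomials with invertible initial forms: an inverse up to higher
    value turns the fraction into a polynomial, and invertible elements keep their value at the next
    level, so congruences survive the passage. Two objects given by [epsilon] have to be identified:
    coordinates, through freeness of the bases, and the index [e_i] of value groups, which must
    equal the lcm of the denominators of [gamma_i] for [Y_i] to be the vector [B_n]. *)

Definition order_ok (K : fieldType) (G : lmodType rat) (D : MLdata K G) : Prop :=
  [/\ reflexive (gle D), transitive (gle D), antisymmetric (gle D), total (gle D)
    & forall x y z, gle D x y -> gle D (x + z) (y + z)].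

Lemma lmod_rat_mulrn_eq0 (G : lmodType rat) (x : G) n : x *+ n.+1 = 0 -> x = 0.
Proof.
by move/eqP; rewrite -scaler_nat scaler_eq0 pnatr_eq0 /= => /eqP.
Qed.

Section Values.
Variables (K : fieldType) (G : lmodType rat) (D : MLdata K G).
Hypothesis HO : order_ok D.
Implicit Types a b c d : option G.
Local Notation vle := (vle D).
Local Notation vlt := (vlt D).

Lemma vle_refl a : vle a a.
Proof. by case: HO => r _ _ _ _; case: a => //= x; apply: r. Qed.

Lemma vle_trans b a c : vle a b -> vle b c -> vle a c.
Proof.
case: HO => _ t _ _ _; case: a b c => [x|] [y|] [z|] //=; exact: t.
Qed.

Lemma vle_anti a b : vle a b -> vle b a -> a = b.
Proof.
case: HO => _ _ anti _ _; case: a b => [x|] [y|] //= h1 h2.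
by congr Some; apply: anti; rewrite h1 h2.
Qed.

Lemma vle_total a b : vle a b || vle b a.
Proof. by case: HO => _ _ _ t _; case: a b => [x|] [y|] //=; apply: t. Qed.

Lemma vle_None a : vle a None. Proof. by case: a. Qed.
Hint Resolve vle_refl vle_None : core.

Lemma vltNge a b : vlt a b = ~~ vle b a.
Proof.
rewrite /Defs.vlt; case: eqP => [->|ne]; first by rewrite vle_refl.
rewrite andbT; have := vle_total a b; case: (boolP (vle b a)) => hb ha.
  by apply/negP => h; apply: ne; apply: vle_anti.
by move: ha; rewrite orbF.
Qed.

Lemma vltW a b : vlt a b -> vle a b. Proof. by case/andP. Qed.

Lemma vlt_irr a : vlt a a = false.
Proof. by rewrite vltNge vle_refl. Qed.

Lemma vle_lt_trans b a c : vle a b -> vlt b c -> vlt a c.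
Proof.
rewrite !vltNge => h; apply: contra => h'; exact: vle_trans h' h.
Qed.

Lemma vlt_le_trans b a c : vlt a b -> vle b c -> vlt a c.
Proof.
rewrite !vltNge => h h'; apply: contra h => h; exact: vle_trans h' h.
Qed.

Lemma vle_eqVlt a b : vle a b -> a = b \/ vlt a b.
Proof. by rewrite /Defs.vlt => ->; case: eqP => [->|_]; [left|right]. Qed.

Lemma vlt_None a : a <> None -> vlt a None.
Proof. by case: a. Qed.

Lemma vaddC : commutative (@vadd G).
Proof. by move=> [x|] [y|] //=; rewrite addrC. Qed.

Lemma vaddA : associative (@vadd G).
Proof. by move=> [x|] [y|] [z|] //=; rewrite addrA. Qed.

Lemma vadd0 a : vadd a (Some 0) = a.
Proof. by case: a => //= x; rewrite addr0. Qed.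

Lemma vaddN a : vadd a None = None. Proof. by case: a. Qed.

Lemma vadd_neqNone a b : a <> None -> b <> None -> vadd a b <> None.
Proof. by case: a b => [x|] [y|]. Qed.

Lemma vle_add a b c d : vle a b -> vle c d -> vle (vadd a c) (vadd b d).
Proof.
case: HO => _ t _ _ add; case: a b c d => [x|] [y|] [z|] [w|] //= h1 h2.
by apply: t (add _ _ _ h1) _; rewrite ![y + _]addrC; apply: add.
Qed.

(** Strictness needs [a] finite: with [a = None] both sums would be [None]. *)
Lemma vlt_add a b c d : a <> None -> vle a b -> vlt c d -> vlt (vadd a c) (vadd b d).
Proof.
case: a => // x _ le_ab /andP[le_cd ne]; rewrite /Defs.vlt vle_add //=.
apply: contraNneq ne => eq; case: b c d le_ab le_cd eq => [y|] [z|] [w|] //=.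
move=> le_xy le_zw [eq]; apply/eqP; apply: vle_anti => //=.
case: HO => _ t _ _ add.
have := add _ _ (z - y) le_xy; rewrite !addrA eq.
by rewrite [y + w]addrC [y + z]addrC !addrK.
Qed.

Lemma vle_vmin x a b : vle x (vmin D a b) = vle x a && vle x b.
Proof.
rewrite /vmin; case: ifP => h; apply/idP/andP => [h1|[]] //; split=> //.
  exact: vle_trans h1 h.
by apply: vle_trans h1 _; have := vle_total a b; rewrite h.
Qed.

Lemma vle_vminl x (s : seq (option G)) : vle x (vminl D s) = all (vle x) s.
Proof. by elim: s => [|y s IH] /=; rewrite ?vle_None // vle_vmin IH. Qed.

Lemma vminl_in (s : seq (option G)) : vminl D s <> None -> vminl D s \in s.
Proof.
elim: s => [|y s IH] //=; rewrite /vmin; case: ifP => h; first by rewrite in_cons eqxx.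
by move=> /IH h'; rewrite in_cons h' orbT.
Qed.

(* The ultrametric inequality is stated through lower bounds so that no minimum of values occurs. *)
Definition ultrametric (T : zmodType) (m : T -> option G) : Prop :=
  m 0 = None /\ forall c x y, vle c (m x) -> vle c (m y) -> vle c (m (x + y)).

Section Ultrametric.
Variables (T : zmodType) (m : T -> option G).
Hypothesis Hm : ultrametric m.

Lemma fval_sum c I (r : seq I) (P : pred I) (F : I -> T) :
  (forall i, P i -> vle c (m (F i))) -> vle c (m (\sum_(i <- r | P i) F i)).
Proof.
move=> h; elim/big_rec: _ => [|i x Pi]; first by rewrite Hm.1.
by apply: Hm.2; apply: h.
Qed.

Lemma fvalD_lt c x y : vlt c (m x) -> vlt c (m y) -> vlt c (m (x + y)).
Proof.
case/orP: (vle_total (m x) (m y)) => h h1 h2.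
  by apply: vlt_le_trans h1 _; apply: Hm.2.
by apply: vlt_le_trans h2 _; apply: Hm.2.
Qed.

Lemma fval_sum_lt c I (r : seq I) (P : pred I) (F : I -> T) : c <> None ->
  (forall i, P i -> vlt c (m (F i))) -> vlt c (m (\sum_(i <- r | P i) F i)).
Proof.
move=> hc h; elim/big_rec: _ => [|i x Pi]; first by rewrite Hm.1 vlt_None.
by apply: fvalD_lt; apply: h.
Qed.

End Ultrametric.

Record is_val (T : idomainType) (m : T -> option G) : Prop := IsVal {
  fval_ultra : ultrametric m;
  fval_neqNone : forall x, x != 0 -> m x <> None;
  fvalM : forall x y, m (x * y) = vadd (m x) (m y) }.

Section ValTheory.
Variables (T : idomainType) (m : T -> option G).
Hypothesis Hm : is_val m.

Lemma fval0 : m 0 = None. Proof. exact: (fval_ultra Hm).1. Qed.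

Lemma fvalD c x y : vle c (m x) -> vle c (m y) -> vle c (m (x + y)).
Proof. exact: (fval_ultra Hm).2. Qed.

Lemma fval1 : m 1 = Some 0.
Proof.
have := fvalM Hm 1 1; rewrite mulr1.
case e: (m 1) => [a|]; last by case: (fval_neqNone Hm (oner_neq0 T)).
by case=> /eqP; rewrite -subr_eq0 opprD addrA subrr sub0r oppr_eq0 => /eqP ->.
Qed.

Lemma fvalX x n : m (x ^+ n) = if m x is Some g then Some (g *+ n) else if n is 0 then Some 0 else None.
Proof.
elim: n => [|n IH]; first by rewrite expr0 fval1; case: (m x).
by rewrite exprS (fvalM Hm) IH; case: (m x) => //= a; rewrite mulrS.
Qed.

Lemma fvalX_Some x n g : m x = Some g -> m (x ^+ n) = Some (g *+ n).
Proof. by rewrite fvalX => ->. Qed.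

(** The value of [-1] is killed by [2], and a rational vector space has no torsion. *)
Lemma fvalN x : m (- x) = m x.
Proof.
rewrite -mulN1r (fvalM Hm).
have := fvalM Hm (-1) (-1); rewrite mulrNN mulr1 fval1.
case: (m (-1)) => [a|] //= [] /esym e; have /lmod_rat_mulrn_eq0 -> : a *+ 2 = 0.
  by rewrite mulr2n.
by case: (m x) => //= b; rewrite add0r.
Qed.

Lemma fvalB c x y : vle c (m x) -> vle c (m y) -> vle c (m (x - y)).
Proof. by move=> h1 h2; apply: fvalD => //; rewrite fvalN. Qed.

Lemma fvalB_lt c x y : vlt c (m x) -> vlt c (m y) -> vlt c (m (x - y)).
Proof. by move=> h1 h2; apply: (fvalD_lt (fval_ultra Hm)) => //; rewrite fvalN. Qed.

Lemma fvalD_eq x y : vlt (m x) (m y) -> m (x + y) = m x.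
Proof.
move=> h; apply: vle_anti; last by apply: fvalD => //; apply: vltW.
have [//|] := boolP (vle (m (x + y)) (m x)); rewrite -vltNge => h'.
by have := fvalB_lt h' h; rewrite addrK vlt_irr.
Qed.

Lemma fvalBr_eq x y : vlt (m y) (m (x - y)) -> m x = m y.
Proof. by move/fvalD_eq; rewrite addrC subrK. Qed.

End ValTheory.
End Values.

(** * Augmentations *)

Section Expansion.
Variables (K : fieldType) (p : {poly K}).
Hypothesis size_p : (1 < size p)%N.
Implicit Types f a q : {poly K}.

Let p_neq0 : p != 0.
Proof. by rewrite -size_poly_eq0 -lt0n (ltn_trans _ size_p). Qed.

Lemma size_expansion_coef f s : (size (coefx p f s) < size p)%N.
Proof. by rewrite ltn_modp. Qed.

Lemma coefx0 f : coefx p f 0 = f %% p.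
Proof. by rewrite /coefx expr0 divp1. Qed.

Lemma coefxS f s : coefx p f s.+1 = coefx p (f %/ p) s.
Proof. by rewrite /coefx divp_divl exprS. Qed.

Lemma coefxD f h s : coefx p (f + h) s = coefx p f s + coefx p h s.
Proof. by rewrite /coefx divpD modpD. Qed.

Lemma coefx_poly0 s : coefx p 0 s = 0.
Proof. by rewrite /coefx div0p mod0p. Qed.

Lemma coefx_add_mul0 a q : (size a < size p)%N -> coefx p (q * p + a) 0 = a.
Proof. by move=> sa; rewrite coefx0 modp_addl_mul_small. Qed.

Lemma coefx_add_mulS a q s : (size a < size p)%N ->
  coefx p (q * p + a) s.+1 = coefx p q s.
Proof. by move=> sa; rewrite coefxS divp_addl_mul_small. Qed.

Lemma coefx_small a s : (size a < size p)%N -> coefx p a s = if s is 0 then a else 0.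
Proof.
move=> sa; case: s => [|s]; first by rewrite coefx0 modp_small.
by rewrite coefxS divp_small // coefx_poly0.
Qed.

Lemma coefx_shift f k s : coefx p (f * p ^+ k) (k + s) = coefx p f s.
Proof.
elim: k => [|k IH]; first by rewrite expr0 mulr1.
by rewrite addSn coefxS exprSr mulrA mulpK.
Qed.

Lemma coefx_shift_lt f k s : (s < k)%N -> coefx p (f * p ^+ k) s = 0.
Proof.
elim: k s => [|k IH] [|s] // lt_sk; rewrite exprSr mulrA.
  by rewrite coefx0 modp_mull.
by rewrite coefxS mulpK // IH.
Qed.

Lemma expansion_take f N :
  f = \sum_(i < N) coefx p f i * p ^+ i + (f %/ p ^+ N) * p ^+ N.
Proof.
elim: N => [|N IH]; first by rewrite big_ord0 expr0 divp1 mulr1 add0r.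
rewrite {1}IH big_ord_recr /= -addrA; congr (_ + _).
rewrite {1}(divp_eq (f %/ p ^+ N) p) divp_divl -exprSr -[X in X %% p]/(f %/ p ^+ N).
by rewrite mulrDl addrC -mulrA -exprS.
Qed.

(** Since [p] is not constant, [p ^+ N] has size greater than [N]. This is why the range [size f] in
    [muR] covers the whole expansion. *)
Lemma expansion_div0 f N : (size f <= N)%N -> f %/ p ^+ N = 0.
Proof.
move=> le_fN; rewrite divp_small // (leq_ltn_trans le_fN) //.
have e: p ^+ N != 0 by rewrite expf_neq0.
have := size_exp p N; move: e; rewrite -size_poly_gt0.
by case: (size (p ^+ N)) => //= k _ ->; rewrite ltnS leq_pmull // -subn1 subn_gt0.
Qed.

Lemma coefx_ge f s : (size f <= s)%N -> coefx p f s = 0.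
Proof. by move=> h; rewrite /coefx expansion_div0 // mod0p. Qed.

Lemma expansion f N : (size f <= N)%N -> f = \sum_(i < N) coefx p f i * p ^+ i.
Proof. by move=> h; rewrite {1}(expansion_take f N) expansion_div0 // mul0r addr0. Qed.

End Expansion.

Section Augmentation.
Variables (K : fieldType) (G : lmodType rat) (D : MLdata K G).
Hypothesis HO : order_ok D.
Local Notation vle := (vle D).
Local Notation vlt := (vlt D).

(* [muR D i.+1] is convertible to [augment (muR D i) (phi D i) (gam D i)]. *)
Definition augment (m : {poly K} -> option G) (p : {poly K}) (g : G) (f : {poly K}) :=
  vminl D [seq vadd (m (coefx p f s)) (Some (g *+ s)) | s <- iota 0 (size f)].

(* What an augmentation needs, expressed only on remainders modulo [p]: this covers
   both [v] with [x + a] and a valuation of [K[x]] with one of its key polynomials. *)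
Record augmentable (m : {poly K} -> option G) (p : {poly K}) (g : G) : Prop := Augmentable {
  aug_size : (1 < size p)%N;
  aug_ultra : ultrametric D m;
  aug_neqNone : forall a : {poly K}, a != 0 -> (size a < size p)%N -> m a <> None;
  augM : forall a b : {poly K}, a != 0 -> b != 0 -> (size a < size p)%N -> (size b < size p)%N ->
    m ((a * b) %% p) = vadd (m a) (m b) /\
    vlt (vadd (m a) (m b)) (vadd (m ((a * b) %/ p)) (Some g)) }.

(** Invertibility of the initial form of [f] in the graded algebra: [f * h] and [1] have the same
    initial form. *)
Definition munit (m : {poly K} -> option G) (f : {poly K}) :=
  exists h, vlt (Some 0) (m (f * h - 1)).

Section Step.
Variables (m : {poly K} -> option G) (p : {poly K}) (g : G).
Hypothesis Hs : augmentable m p g.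
Local Notation m' := (augment m p g).
Local Notation term f s := (vadd (m (coefx p f s)) (Some (g *+ s))).
Let size_p := aug_size Hs.
Let m0 : m 0 = None := (aug_ultra Hs).1.
Implicit Types f h a b : {poly K}.

(** Digits of index at least [size f] are zero and have value [None], so the range of the minimum
    can be forgotten and sums and shifts compared digit by digit. *)
Lemma augment_glb c f : vle c (m' f) <-> forall s, vle c (term f s).
Proof.
rewrite (vle_vminl HO) all_map; split=> [/allP h s|h]; last first.
  by apply/allP => s _; apply: h.
have [lt_s|le_s] := ltnP s (size f); first by apply: h; rewrite mem_iota.
by rewrite coefx_ge // m0; case: c {h}.
Qed.

Lemma augment_le f s : vle (m' f) (term f s).
Proof. by move: s; apply/augment_glb; apply: vle_refl. Qed.

Lemma augment_neqNone f : f != 0 -> m' f <> None.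
Proof.
move=> f0 e; case/eqP: f0; rewrite (expansion size_p (leqnn (size f))) big1 // => i _.
have := augment_le f i; rewrite e.
have [->|c0] := eqVneq (coefx p f i) 0; first by rewrite mul0r.
have := aug_neqNone Hs c0 (size_expansion_coef size_p f i).
by case: (m _).
Qed.

Lemma augment_attained f : f != 0 -> exists s, m' f = term f s.
Proof.
move=> /augment_neqNone /(@vminl_in _ _ D) /mapP[s _ e]; by exists s.
Qed.

Lemma augment_small a : (size a < size p)%N -> m' a = m a.
Proof.
move=> sa; apply: (vle_anti HO).
  by have := augment_le a 0; rewrite coefx_small // mulr0n vadd0.
apply/augment_glb => -[|s]; rewrite coefx_small //; first by rewrite mulr0n vadd0 vle_refl.
by rewrite m0 vle_None.
Qed.

Lemma augment_ultra : ultrametric D m'.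
Proof.
split=> [|c f h hf hh]; first by rewrite /augment size_poly0.
apply/augment_glb => s; rewrite coefxD.
have /augment_glb/(_ s) := hf; have /augment_glb/(_ s) := hh; move: {hf hh} c => c.
have shift x : vle c (vadd x (Some (g *+ s))) <-> vle (vadd c (Some (- (g *+ s)))) x.
  split=> h1.
    have := vle_add HO h1 (vle_refl HO (Some (- (g *+ s)))).
    by rewrite -vaddA /= subrr vadd0.
  have := vle_add HO h1 (vle_refl HO (Some (g *+ s))).
  by rewrite -vaddA /= addNr vadd0.
by move=> /shift h1 /shift h2; apply/shift; apply: (aug_ultra Hs).2.
Qed.

Lemma augment_shift f k : m' (f * p ^+ k) = vadd (m' f) (Some (g *+ k)).
Proof.
apply: (vle_anti HO).
  have [->|f0] := eqVneq f 0; first by rewrite mul0r augment_ultra.1.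
  have [s ->] := augment_attained f0.
  have := augment_le (f * p ^+ k) (k + s); rewrite coefx_shift //.
  by rewrite -vaddA /= mulrnDr addrC.
apply/augment_glb => s; have [lt_sk|le_ks] := ltnP s k.
  by rewrite coefx_shift_lt // m0 vle_None.
rewrite -(subnKC le_ks) coefx_shift // [(k + _)%N]addnC mulrnDr.
rewrite -[Some (_ + _)]/(vadd (Some (g *+ (s - k))) (Some (g *+ k))) vaddA.
by apply: (vle_add HO); [apply: augment_le|apply: vle_refl].
Qed.

(** [m] is multiplicative on remainders only; the products [1 * 1] and [(-1) * (-1)] are their own
    remainders, and absence of torsion does the rest. *)
Lemma aug_one : m 1%R = Some 0 /\ m (-1)%R = Some 0.
Proof.
have s1 : (size (1%R : {poly K}) < size p)%N by rewrite size_poly1.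
have sN1 : (size ((-1)%R : {poly K}) < size p)%N by rewrite size_polyN.
have N10 : (-1 : {poly K}) != 0 by rewrite oppr_eq0 oner_neq0.
have [e1 _] := augM Hs N10 N10 sN1 sN1.
have [e2 _] := augM Hs (oner_neq0 _) (oner_neq0 _) s1 s1.
move: e1 e2; rewrite mulrNN !mulr1 modp_small //.
have := aug_neqNone Hs N10 sN1; have := aug_neqNone Hs (oner_neq0 _) s1.
case: (m 1%R) (m (-1)%R) => // x [y|] // _ _ [exy] [/esym e2].
have x0: x = 0 by apply: (addrI x); rewrite addr0.
suff -> : y = 0 by rewrite x0.
by apply: (@lmod_rat_mulrn_eq0 _ _ 1); rewrite mulr2n -exy.
Qed.

Lemma augment_p : m' p = Some g.
Proof.
have := augment_shift 1%R 1; rewrite mul1r expr1 mulr1n => ->.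
by rewrite augment_small ?size_poly1 // aug_one.1 vaddC vadd0.
Qed.

(** A product of two digits has at most two digits, its remainder and its quotient by [p], because
    that quotient is again shorter than [p]; [augM] controls both. *)
Lemma augment_mul_small a b : (size a < size p)%N -> (size b < size p)%N ->
  vle (vadd (m a) (m b)) (m' (a * b)).
Proof.
move=> sa sb.
have [->|a0] := eqVneq a 0; first by rewrite mul0r m0 augment_ultra.1.
have [->|b0] := eqVneq b 0; first by rewrite mulr0 augment_ultra.1 vle_None.
have [hc hq] := augM Hs a0 b0 sa sb.
rewrite (divp_eq (a * b) p).
have sc: (size ((a * b) %% p)%R < size p)%N.
  by rewrite ltn_modp -size_poly_eq0 -lt0n (ltn_trans _ size_p).
have sq: (size ((a * b) %/ p)%R < size p)%N.
  rewrite size_divp; last by rewrite -size_poly_eq0 -lt0n (ltn_trans _ size_p).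
  rewrite size_mul //; move: sa sb (aug_size Hs). move: (size a) (size b) (size p) => x y z. lia.
apply/augment_glb => -[|[|s]].
- by rewrite coefx_add_mul0 // hc mulr0n vadd0 vle_refl.
- by rewrite coefx_add_mulS // coefx_small // mulr1n vltW.
- by rewrite coefx_add_mulS // coefx_small // m0 vle_None.
Qed.

Lemma augment_mul_ge f h : vle (vadd (m' f) (m' h)) (m' (f * h)).
Proof.
rewrite {2}(expansion size_p (leqnn (size f))) mulr_suml.
apply: (fval_sum augment_ultra) => i _.
rewrite {2}(expansion size_p (leqnn (size h))) mulr_sumr.
apply: (fval_sum augment_ultra) => j _.
rewrite mulrACA -exprD augment_shift.
apply: vle_trans (vle_add HO (augment_le f i) (augment_le h j)) _ => //.
have -> : forall x y : option G, vadd (vadd x (Some (g *+ i))) (vadd y (Some (g *+ j))) =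
     vadd (vadd x y) (Some (g *+ (i + j))).
  by move=> [x|] [y|] //=; rewrite mulrnDr addrACA.
apply: (vle_add HO); last exact: vle_refl.
by apply: augment_mul_small; apply: size_expansion_coef.
Qed.

Lemma augmentN f : m' (- f) = m' f.
Proof.
have le_N h : vle (m' h) (m' (- h)).
  have := augment_mul_ge (-1) h.
  by rewrite mulN1r augment_small ?size_polyN ?size_poly1 // aug_one.2 vaddC vadd0.
by apply: (vle_anti HO); [rewrite -{2}[f]opprK|]; apply: le_N.
Qed.

(** [s] is the least index attaining the minimum, so every term of the head [A] is strictly larger;
    [a] is the digit at [s], and [B * p] collects the later ones. *)
Lemma augment_split f : f != 0 -> exists s A a B,
  [/\ f = A + (B * p + a) * p ^+ s, (size a < size p)%N, a != 0,
      m' f = vadd (m a) (Some (g *+ s)) & vlt (m' f) (m' A)].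
Proof.
move=> f0; have ex: exists s, m' f == term f s.
  by have [s ->] := augment_attained f0; exists s; apply/eqP.
case: (ex_minnP ex) => s /eqP es mins.
exists s, (\sum_(i < s) coefx p f i * p ^+ i), (coefx p f s), (f %/ p ^+ s.+1); split=> //.
- rewrite {1}(expansion_take p f s); congr (_ + _ * _).
  by rewrite {1}(divp_eq (f %/ p ^+ s) p) divp_divl -exprSr.
- exact: size_expansion_coef.
- by apply/eqP => c0; have := augment_neqNone f0; rewrite es c0 m0.
apply: (fval_sum_lt HO augment_ultra); first exact: augment_neqNone.
move=> i _; rewrite augment_shift (augment_small (a := coefx p f i)); last exact: size_expansion_coef.
case: (vle_eqVlt (augment_le f i)) => // /eqP /mins.
by rewrite leqNgt ltn_ord.
Qed.

(** As in the lemma of Gauss: with [a] and [b] the first minimal digits of [f] and [h], the lowest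
    digit of the product of the tails is [(a * b) %% p], of value exactly [m a + m b]. *)
Lemma augment_mul f h : m' (f * h) = vadd (m' f) (m' h).
Proof.
have [->|f0] := eqVneq f 0; first by rewrite mul0r augment_ultra.1.
have [->|h0] := eqVneq h 0; first by rewrite mulr0 augment_ultra.1 vaddN.
apply: (vle_anti HO); last exact: augment_mul_ge.
have [s [A [a [B [ef sa a0 mf ltA]]]]] := augment_split f0.
have [t [C [b [E [eh sb b0 mh ltC]]]]] := augment_split h0.
set fA := (B * p + a) * p ^+ s in ef; set hC := (E * p + b) * p ^+ t in eh.
have nf := augment_neqNone f0; have nh := augment_neqNone h0.
have prod_le : vle (m' (fA * hC)) (vadd (m' f) (m' h)).
  have -> : fA * hC = ((B * p + a) * (E * p + b)) * p ^+ (s + t).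
    by rewrite /fA /hC mulrACA exprD.
  have -> : (B * p + a) * (E * p + b) =
            (B * E * p + B * b + a * E + (a * b) %/ p) * p + (a * b) %% p.
    rewrite [in RHS]mulrDl -addrA -divp_eq; ring.
  rewrite augment_shift.
  have [hc _] := augM Hs a0 b0 sa sb.
  apply: vle_trans (vle_add HO (augment_le _ 0) (vle_refl HO _)) _ => //.
  rewrite coefx_add_mul0; last first.
    by rewrite ltn_modp -size_poly_eq0 -lt0n (ltn_trans _ size_p).
  rewrite hc mulr0n vadd0 mf mh; case: (m a) (m b) => [x|] [y|] //=.
  by rewrite mulrnDr addrACA; case: HO.
have [//|] := boolP (vle (m' (f * h)) (vadd (m' f) (m' h))).
(* Otherwise [fA * hC], which differs from [f * h] by [A * h] and [fA * C], would have too large a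
   value as well. *)
rewrite -(vltNge HO) => lt; exfalso.
have ltfA : vle (m' f) (m' fA).
  have -> : fA = f - A by rewrite ef [A + _]addrC addrK.
  by apply: augment_ultra.2; rewrite ?augmentN ?vle_refl // vltW.
have lt1 : vlt (vadd (m' f) (m' h)) (m' (A * h)).
  apply: vlt_le_trans (augment_mul_ge A h) => //.
  by rewrite ![vadd _ (m' h)]vaddC; apply: vlt_add => //; apply: vle_refl.
have lt2 : vlt (vadd (m' f) (m' h)) (m' (fA * C)).
  apply: vlt_le_trans (augment_mul_ge fA C) => //.
  by apply: vlt_add.
have : vlt (vadd (m' f) (m' h)) (m' (fA * hC)).
  have -> : fA * hC = f * h + (- (A * h) + - (fA * C)).
    rewrite [in RHS]ef [in RHS]eh; ring.
  apply: (fvalD_lt HO augment_ultra) => //.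
  by apply: (fvalD_lt HO augment_ultra); rewrite augmentN.
by rewrite (vltNge HO) prod_le.
Qed.

Lemma augment_is_val : is_val D m'.
Proof.
split; [exact: augment_ultra|exact: augment_neqNone|exact: augment_mul].
Qed.
End Step.
End Augmentation.

(** * Units of the graded algebra, and key polynomials *)

Section Units.
Variables (K : fieldType) (G : lmodType rat) (D : MLdata K G).
Hypothesis HO : order_ok D.
Local Notation vle := (vle D).
Local Notation vlt := (vlt D).
Implicit Types (m : {poly K} -> option G) (p f h a b : {poly K}) (g : G).

Lemma munit_val m f h : is_val D m -> vlt (Some 0) (m (f * h - 1)) ->
  vadd (m f) (m h) = Some 0.
Proof.
move=> Hm lt; rewrite -(fvalM Hm) -(fval1 Hm); apply: (fvalBr_eq HO Hm).
by rewrite (fval1 Hm).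
Qed.

Lemma munit_neq0 m f : is_val D m -> munit D m f -> f != 0.
Proof.
move=> Hm [h /(munit_val Hm) e]; apply/eqP => f0.
by move: e; rewrite f0 (fval0 Hm).
Qed.

Lemma munit1 m : is_val D m -> munit D m 1.
Proof. by move=> Hm; exists 1; rewrite mulr1 subrr (fval0 Hm). Qed.

Lemma munitM m f h : is_val D m -> munit D m f -> munit D m h -> munit D m (f * h).
Proof.
move=> Hm [f' hf] [h' hh]; exists (f' * h').
have -> : f * h * (f' * h') - 1 = (f * f' - 1) * (h * h') + (h * h' - 1) by ring.
apply: (fvalD_lt HO (fval_ultra Hm)) => //.
by rewrite (fvalM Hm) (fvalM Hm h) (munit_val Hm hh) vadd0.
Qed.

Lemma munitX m f n : is_val D m -> munit D m f -> munit D m (f ^+ n).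
Proof.
move=> Hm Hf; elim: n => [|n IH]; first by rewrite expr0; apply: munit1.
by rewrite exprS; apply: munitM.
Qed.

(** A Bezout cofactor of [a], reduced modulo [p], is an inverse up to a multiple of [p], and [augM]
    shows that this multiple has positive value. *)
Lemma augment_small_unit m p g a : augmentable D m p g ->
  a != 0 -> (size a < size p)%N -> munit D (augment D m p g) a.
Proof.
move=> Hs a0 sa; have size_p := aug_size Hs.
have p0 : p != 0 by rewrite -size_poly_eq0 -lt0n (ltn_trans _ size_p).
(* A common divisor would give [p = c * d] with both factors shorter than [p], and the remainder [0]
   would have the finite value [m c + m d]. *)
have cop : coprimep a p.
  rewrite coprimep_def; apply/negPn/negP => sd.
  have /dvdpP[c ec] := dvdp_gcdr a p; set d := gcdp a p in sd ec.
  have c0 : c != 0 by apply: contra_neq p0 => c0; rewrite ec c0 mul0r.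
  have d0 : d != 0 by apply: contra_neq p0 => d0; rewrite ec d0 mulr0.
  have ltd : (size d < size p)%N by apply: leq_ltn_trans sa; apply: dvdp_leq (dvdp_gcdl a p).
  have ltc : (size c < size p)%N.
    rewrite ec size_mul //; move: sd d0 c0; rewrite -!size_poly_gt0.
    by move: (size c) (size d) => x y; lia.
  have [e _] := augM Hs c0 d0 ltc ltd.
  move: e; rewrite -ec modpp (aug_ultra Hs).1.
  have := aug_neqNone Hs c0 ltc; have := aug_neqNone Hs d0 ltd.
  by case: (m c) (m d) => [x|] [y|].
have /Bezout_eq1_coprimepP[[u w] /= ebez] := cop.
set u0 := u %% p; set q := - (w + (u %/ p) * a).
have eq : a * u0 = q * p + 1.
  rewrite -[1]ebez {1}(divp_eq u p) /q -/u0; ring.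
have s1 : (size (1%R : {poly K}) < size p)%N by rewrite size_poly1.
have u00 : u0 != 0.
  apply: contraTneq (oner_neq0 {poly K}) => e; rewrite negbK.
  by rewrite (modpP eq s1) e mulr0 mod0p.
have su0 : (size u0 < size p)%N by rewrite ltn_modp.
have [] := augM Hs a0 u00 sa su0.
rewrite -(modpP eq s1) -(divpP eq s1) (aug_one Hs).1 => <- lt.
exists u0; rewrite eq addrK -[q * p]/(q * p ^+ 1) (augment_shift HO Hs) mulr1n.
rewrite augment_small // (divpP eq s1) size_divp // size_mul //.
by move: sa su0 size_p; move: (size a) (size u0) (size p) => x y z; lia.
Qed.

Section KeyPolynomial.
Variables (m : {poly K} -> option G) (p : {poly K}) (g : G).
Hypothesis (Hm : is_val D m) (Hp : key_poly D m p) (lt_g : vlt (m p) (Some g)).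
Local Notation m' := (augment D m p g).

Lemma key_size : (1 < size p)%N.
Proof.
case: Hp => mon n1 _ _; rewrite ltnNge; apply/negP => s1.
apply: n1; right; exists 1; have -> : p = 1.
  have s : size p = 1%N.
    by apply/eqP; rewrite eqn_leq s1 size_poly_gt0 monic_neq0.
  have /eqP/size_poly1P[c c0 ep] := s; move: mon.
  by rewrite ep monicE lead_coefC => /eqP ->.
by rewrite mulr1 subrr (fval0 Hm) (fval1 Hm).
Qed.

Let p_neq0 : p != 0.
Proof. by rewrite -size_poly_eq0 -lt0n (ltn_trans _ key_size). Qed.

Let size_rem f : (size (f %% p)%R < size p)%N.
Proof. by rewrite ltn_modp. Qed.

(** A remainder of smaller value than [f] would have the initial form of [- (f %/ p) * p], hence be
    a polynomial shorter than [p] and divisible by it. *)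
Lemma key_rem_ge f : vle (m f) (m (f %% p)).
Proof.
have [//|] := boolP (vle _ _); rewrite -(vltNge HO) => lt; exfalso.
case: Hp => _ _ _ /(_ (f %% p)) h; apply: h => //.
  by apply/eqP => e; move: lt; rewrite e (fval0 Hm); case: (m f).
right; exists (- (f %/ p)).
by rewrite mulrN opprK addrC mulrC -divp_eq.
Qed.

Lemma key_rem_eq f : ~ mu_dvd D m p f -> m (f %% p) = m f.
Proof.
move=> nd; case: (vle_eqVlt (key_rem_ge f)) => // lt; case: nd; right.
by exists (f %/ p); rewrite {2}(divp_eq f p) mulrC addrC addKr.
Qed.

Lemma key_quo_ge f : vle (m f) (vadd (m (f %/ p)) (m p)).
Proof.
rewrite -(fvalM Hm).
have -> : f %/ p * p = f - f %% p by rewrite {2}(divp_eq f p) addrK.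
by apply: (fvalB Hm); [apply: vle_refl|apply: key_rem_ge].
Qed.

Lemma key_quo_gt f : f != 0 -> vlt (m f) (vadd (m (f %/ p)) (Some g)).
Proof.
move=> f0; have := key_quo_ge f; case e: (m (f %/ p)) => [c|].
  move/(vle_lt_trans HO); apply; apply: vlt_add => //; exact: vle_refl.
by move=> _; apply: vlt_None; apply: (fval_neqNone Hm).
Qed.

(** By primality and minimality [p] divides no product of two shorter polynomials, so the remainder
    keeps the value; the quotient gains because [g] exceeds [m p]. *)
Lemma key_augmentable : augmentable D m p g.
Proof.
split; [exact: key_size|exact: fval_ultra|by move=> a a0 _; apply: (fval_neqNone Hm)|].
move=> a b a0 b0 sa sb; rewrite -(fvalM Hm); split.
  case: Hp => _ _ prime small; apply: key_rem_eq => /prime[]; exact: small.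
by apply: key_quo_gt; rewrite mulf_neq0.
Qed.

Lemma augment_ge f : vle (m f) (m' f).
Proof.
apply/(augment_glb HO key_augmentable) => s; elim: s f => [|s IH] f.
  by rewrite coefx0 mulr0n vadd0 key_rem_ge.
rewrite coefxS mulrSr -[Some _]/(vadd (Some (g *+ s)) (Some g)) vaddA.
apply: (vle_trans HO (key_quo_ge f)); apply: (vle_add HO); [exact: IH|exact: vltW].
Qed.

(** The initial form of [f] for [m'] is that of its remainder, since [f %/ p * p] has gained value;
    and the remainder, being short, is a unit. *)
Lemma key_notdvd f : ~ mu_dvd D m p f -> m' f = m f /\ munit D m' f.
Proof.
move=> nd; have Hm' := augment_is_val HO key_augmentable.
have f0 : f != 0 by apply/eqP => f0; apply: nd; left.
have r0 : f %% p != 0.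
  apply/eqP => e; have := key_rem_eq nd; rewrite e (fval0 Hm).
  by move/esym; apply: (fval_neqNone Hm).
have er : m' (f %% p) = m f by rewrite (augment_small HO key_augmentable) // key_rem_eq.
have lt : vlt (m f) (m' (f %/ p * p)).
  rewrite (fvalM Hm') (augment_p HO key_augmentable).
  apply: (vlt_le_trans HO (key_quo_gt f0)); apply: (vle_add HO); last exact: vle_refl.
  exact: augment_ge.
split.
  have := fvalD_eq HO Hm' (x := f %% p) (y := f %/ p * p).
  by rewrite er addrC -divp_eq; apply.
have [h hh] := augment_small_unit key_augmentable r0 (size_rem f).
exists h; rewrite {1}(divp_eq f p).
have -> : (f %/ p * p + f %% p) * h - 1 = (f %/ p * p) * h + ((f %% p) * h - 1) by ring.
apply: (fvalD_lt HO (fval_ultra Hm')) => //.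
have e := munit_val Hm' hh; rewrite (fvalM Hm') -e er.
rewrite ![vadd _ (m' h)]vaddC; apply: vlt_add => //; last exact: vle_refl.
by move: e; case: (m' h) => //; rewrite vaddN.
Qed.

(** Otherwise [p] would divide a unit, hence [1]. Together with [key_notdvd] this keeps units, and
    their values, at the next level. *)
Lemma munit_notdvd f : munit D m f -> ~ mu_dvd D m p f.
Proof.
move=> uf; have f0 := munit_neq0 Hm uf; case: uf => h hh [fz|[q hq]].
  by rewrite fz eqxx in f0.
case: Hp => _ n1 _ _; apply: n1; right; exists (q * h).
have -> : 1 - p * (q * h) = (f - p * q) * h - (f * h - 1) by ring.
apply: (fvalB_lt HO Hm); rewrite (fval1 Hm) //.
have e := munit_val Hm hh; rewrite (fvalM Hm) -e.
rewrite ![vadd _ (m h)]vaddC; apply: vlt_add => //; last exact: vle_refl.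
by move: e; case: (m h) => //; rewrite vaddN.
Qed.

Lemma munit_augment f : munit D m f -> m' f = m f /\ munit D m' f.
Proof. by move/munit_notdvd/key_notdvd. Qed.

End KeyPolynomial.
End Units.

(** * The chain and its value groups *)

Section Index.
Variable G : lmodType rat.

Definition subgroup (B : G -> Prop) : Prop := B 0 /\ forall x y, B x -> B y -> B (x - y).

Lemma subgroupN (B : G -> Prop) x : subgroup B -> B x -> B (- x).
Proof. by case=> B0 BB Bx; rewrite -sub0r; apply: BB. Qed.

Lemma subgroupD (B : G -> Prop) x y : subgroup B -> B x -> B y -> B (x + y).
Proof. by move=> sB Bx By; rewrite -[y]opprK; apply: sB.2 => //; apply: subgroupN. Qed.

Lemma subgroupMz (B : G -> Prop) x z : subgroup B -> B x -> B (x *~ z).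
Proof.
move=> sB Bx; have Bn n : B (x *+ n).
  elim: n => [|n IH]; first by rewrite mulr0n; case: sB.
  by rewrite mulrS; apply: subgroupD.
by case: z => n; [apply: Bn|rewrite NegzE mulrNz; apply: subgroupN => //; apply: Bn].
Qed.

Lemma subgroup_sum (B : G -> Prop) I (r : seq I) (P : pred I) (F : I -> G) :
  subgroup B -> (forall i, P i -> B (F i)) -> B (\sum_(i <- r | P i) F i).
Proof.
move=> sB h; elim/big_rec: _ => [|i x Pi]; first by case: sB.
by apply: subgroupD => //; apply: h.
Qed.

(** Matching representatives of the same coset is injective, so the index is unique and [epsilon]
    has no freedom. *)
Lemma is_index_leq (A B : G -> Prop) e e' :
  subgroup B -> is_index A B e -> is_index A B e' -> (e <= e')%N.
Proof.
move=> sB [t [At uni]] [t' [At' uni']].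
have [f hf] : exists f : 'I_e -> 'I_e', forall k, B (t k - t' (f k)).
  exists (fun k => proj1_sig (constructive_indefinite_description _ (uni' _ (At k)))).
  by move=> k; case: (constructive_indefinite_description _ _) => k' [].
have inj : injective f.
  move=> k1 k2 e12; have [k [_ u]] := uni _ (At k1).
  rewrite -(u k1); last by rewrite subrr; case: sB.
  apply: u; have := sB.2 _ _ (hf k1) (hf k2).
  by rewrite e12 opprB addrA subrK.
by have := leq_card f inj; rewrite !card_ord.
Qed.

Lemma gindexE (A B : G -> Prop) e : subgroup B -> is_index A B e -> gindex A B = e.
Proof.
move=> sB ie; have ig : is_index A B (gindex A B) by apply: epsilon_spec; exists e.
by apply/eqP; rewrite eqn_leq !(@is_index_leq A B).
Qed.

End Index.

(** * Values and value groups along the chain *)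

Section Chain.
Variables (K : fieldType) (G : lmodType rat) (D : MLdata K G).
Hypothesis HD : MLchain_ok D.
Local Notation vle := (vle D).
Local Notation vlt := (vlt D).
Local Notation phi := (phi D).
Local Notation gam := (gam D).
Local Notation muR := (muR D).
Local Notation V k := (value_group (muR k)).

Lemma chain_order : order_ok D. Proof. exact: HD.1. Qed.
Let HO := chain_order.

Lemma chain_aug0 : augmentable D (muR 0) (phi 0) (gam 0).
Proof.
have [_ [[v0 vM vD _ _] [[[a ea] _ _] _]]] := HD.
have sp : size (phi 0) = 2 by rewrite ea size_XaddC.
have cst (b : {poly K}) : (size b < size (phi 0))%N -> b = (b`_0)%:P.
  by rewrite sp ltnS => /size1_polyC.
split; first by rewrite sp.
- split=> [|c f h hf hh] /=; first by rewrite coef0; apply/v0.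
  by rewrite coefD; apply: vle_trans (vD _ _) => //; rewrite vle_vmin // hf.
- move=> b b0 /cst eb /= /v0 e; case/eqP: b0.
  by rewrite eb e.
move=> b c b0 c0 sb sc; rewrite (cst b) // (cst c) // -polyCM.
have s : (size ((b`_0 * c`_0)%:P)%R < size (phi 0))%N by rewrite sp (leq_ltn_trans (size_polyC_leq1 _)).
rewrite modp_small // divp_small //= !coefC /= ?coef0 vM (v0 0).2 //; split=> //.
rewrite vlt_None //; apply: vadd_neqNone => /v0 e.
  by case/eqP: b0; rewrite (cst b) // e.
by case/eqP: c0; rewrite (cst c) // e.
Qed.

Lemma chain_val i : (i <= len D)%N -> is_val D (muR i.+1).
Proof.
elim: i => [_|i IH lt]; first exact: (augment_is_val HO chain_aug0).
have [_ [_ [[_ key _] _]]] := HD; have [kp ltg] := key i.+1 lt.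
exact: (augment_is_val HO (key_augmentable HO (IH (ltnW lt)) kp ltg)).
Qed.

Lemma chain_aug i : (i <= len D)%N -> augmentable D (muR i) (phi i) (gam i).
Proof.
case: i => [_|i lt]; first exact: chain_aug0.
have [_ [_ [[_ key _] _]]] := HD; have [kp ltg] := key i.+1 lt.
exact: (key_augmentable HO (chain_val (ltnW lt)) kp ltg).
Qed.

Lemma muR_small i (a : {poly K}) : (i <= len D)%N -> (size a < size (phi i))%N -> muR i.+1 a = muR i a.
Proof. by move=> le; apply: (augment_small HO (chain_aug le)). Qed.

Lemma muR_ge i f : (i < len D)%N -> vle (muR i.+1 f) (muR i.+2 f).
Proof.
move=> lt; have [_ [_ [[_ key _] _]]] := HD; have [kp ltg] := key i.+1 lt.
exact: (augment_ge HO (chain_val (ltnW lt)) kp ltg).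
Qed.

Lemma munit_next i f : (i < len D)%N -> munit D (muR i.+1) f ->
  muR i.+2 f = muR i.+1 f /\ munit D (muR i.+2) f.
Proof.
move=> lt; have [_ [_ [[_ key _] _]]] := HD; have [kp ltg] := key i.+1 lt.
exact: (munit_augment HO (chain_val (ltnW lt)) kp ltg).
Qed.

(** At the step after [i], [phi i] becomes a unit because [phi i.+1] does not divide it; from then
    on it is a unit and its value is frozen. *)
Lemma muR_phi i k : (i <= k <= len D)%N ->
  muR k.+1 (phi i) = Some (gam i) /\ ((i < k)%N -> munit D (muR k.+1) (phi i)).
Proof.
elim: k => [|k IH] /andP[le_ik le_k].
  move: le_ik; rewrite leqn0 => /eqP ->; split=> //.
  exact: (augment_p HO chain_aug0).
move: le_ik; rewrite leq_eqVlt => /orP[/eqP ->|lt_ik].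
  by rewrite ltnn; split=> //; apply: (augment_p HO (chain_aug le_k)).
have [IH1 IH2] := IH (introT andP (conj lt_ik (ltnW le_k))).
move: lt_ik; rewrite ltnS leq_eqVlt => /orP[/eqP e|lt].
  have [_ [_ [[_ key nd] _]]] := HD; have [kp ltg] := key k.+1 le_k.
  have := key_notdvd HO (chain_val (ltnW le_k)) kp ltg (nd k le_k).
  rewrite -e in IH1 *; move=> [e1 un]; split=> // ; exact: etrans e1 IH1.
have [e1 un] := munit_next le_k (IH2 lt).
by split=> //; exact: etrans e1 IH1.
Qed.

Lemma muR_const k c : (k <= (len D).+1)%N -> muR k c%:P = vv D c.
Proof.
elim: k => [_|k IH le]; first by rewrite /= coefC.
rewrite muR_small //; first exact: IH (ltnW le).
exact: leq_ltn_trans (size_polyC_leq1 _) (aug_size (chain_aug le)).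
Qed.

Lemma munit_const k c : (k <= len D)%N -> c != 0 -> munit D (muR k.+1) c%:P.
Proof.
move=> le c0; exists (c^-1)%:P.
by rewrite -polyCM mulfV // subrr (fval0 (chain_val le)).
Qed.

Lemma vv1 : vv D 1 = Some 0.
Proof. by rewrite -(@muR_const 1) // (fval1 (chain_val (leq0n _))). Qed.

Lemma Gamma_subgroup : subgroup (Gamma D).
Proof.
have [_ [[v0 vM _ _ _] _]] := HD.
split=> [|x y [c ec] [d ed]]; first by exists 1; exact: vv1.
exists (c / d); have := vM d d^-1; rewrite [vv D (c / d)]vM ec ed mulfV ?vv1.
  by case: (vv D d^-1) => //= z [] /eqP; rewrite eq_sym addrC addr_eq0 => /eqP ->.
by apply/eqP => /v0; rewrite ed.
Qed.

Lemma value_group_Gamma k x : (k <= (len D).+1)%N -> Gamma D x -> V k x.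
Proof. by move=> le [c ec]; exists c%:P; rewrite muR_const. Qed.

Lemma value_groupD k x y : (k <= (len D).+1)%N -> V k x -> V k y -> V k (x + y).
Proof.
move=> le [f ef] [h eh]; exists (f * h).
case: k le ef eh => [_|k le ef eh]; last by rewrite (fvalM (chain_val le)) ef eh.
by have [_ [[_ vM _ _ _] _]] := HD; rewrite /= coef0M vM => -> ->.
Qed.

(** Polynomials have no inverses to provide opposites. Instead some [y *+ n] lies in [Gamma], and
    [- y] is [y *+ n.-1] minus that element. *)
Lemma value_group_subgroup k : (k <= (len D).+1)%N -> subgroup (V k).
Proof.
move=> le; have VG := value_group_Gamma le; have sG := Gamma_subgroup.
have Vn x n : V k x -> V k (x *+ n).
  move=> Vx; elim: n => [|n IH]; first by rewrite mulr0n; apply: VG; case: sG.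
  by rewrite mulrS; apply: value_groupD.
split=> [|x y Vx Vy]; first by apply: VG; case: sG.
have [_ [[_ _ _ _ tors] _]] := HD; have [n [n0 Gn]] := tors y.
have -> : x - y = x + (y *+ n.-1 + - (y *+ n)).
  by rewrite -{2}(prednK n0) mulrSr opprD addrA addrA addrK.
apply: value_groupD => //; apply: value_groupD => //; first exact: Vn.
by apply: VG; apply: subgroupN.
Qed.

Lemma value_group_step i x : (i <= len D)%N -> V i.+1 x ->
  exists s, V i (x - gam i *+ s).
Proof.
move=> le [f ef]; have f0 : f != 0.
  by apply/eqP => e; move: ef; rewrite e (fval0 (chain_val le)).
have [s es] := augment_attained HO (chain_aug le) f0.
exists s, (coefx (phi i) f s); move: es; rewrite -[augment _ _ _ _ _]/(muR i.+1 f) ef.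
by case: (muR i _) => // u [->]; rewrite addrK.
Qed.

(** The larger value group is obtained from the smaller one by adding multiples of [gam i]. With [e]
    the least positive integer bringing [gam i] into the smaller group, the [gam i *+ k] for [k < e]
    represent the cosets, so [e] is the index. *)
Lemma eidx_spec i : (i <= len D)%N ->
  (0 < eidx D i)%N /\ forall z : int, V i (gam i *~ z) <-> ((eidx D i)%:Z %| z)%Z.
Proof.
move=> le; have sV := value_group_subgroup (leqW le).
(* Excluded middle turns membership into a boolean, so that a least element can be taken. *)
pose P n := if excluded_middle_informative ((0 < n)%N /\ V i (gam i *+ n)) then true else false.
have PP n : P n <-> (0 < n)%N /\ V i (gam i *+ n).
  by rewrite /P; case: excluded_middle_informative.
have exP : exists n, P n.
  have [_ [[_ _ _ _ tors] _]] := HD; have [n [n0 Gn]] := tors (gam i).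
  by exists n; apply/PP; split=> //; apply: value_group_Gamma => //; apply: leqW.
case: (ex_minnP exP) => e /PP[e0 Ve] mine.
have small k : (k < e)%N -> V i (gam i *+ k) -> k = 0%N.
  case: k => // k lt Vk; have := mine k.+1 (proj2 (PP k.+1) (conj isT Vk)).
  by rewrite leqNgt lt.
have ie : is_index (V i.+1) (V i) e.
  exists (fun k : 'I_e => gam i *+ k); split=> [k|x Vx].
    exists (phi i ^+ k).
    by apply: (fvalX_Some (chain_val le)); apply: (muR_phi _).1; rewrite leqnn.
  have [s Vs] := value_group_step le Vx.
  have Vm : V i (x - gam i *+ (s %% e)).
    have -> : x - gam i *+ (s %% e) = (x - gam i *+ s) + (gam i *+ e) *~ (s %/ e)%N.
      rewrite {2}(divn_eq s e) mulrnDr -pmulrn -mulrnA [(e * _)%N]mulnC.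
      by rewrite opprD addrA [RHS]addrAC subrK.
    by apply: subgroupD => //; apply: subgroupMz.
  exists (Ordinal (ltn_pmod s e0)); split=> [//|k' Vk'].
  apply: val_inj => /=.
  have Vd (a b : nat) : V i (x - gam i *+ a) -> V i (x - gam i *+ b) -> (b <= a)%N ->
      V i (gam i *+ (a - b)).
    move=> Va Vb lb; rewrite mulrnBr //.
    have := sV.2 _ _ Vb Va; rewrite opprB addrC addrA subrK; exact.
  have ltm := ltn_pmod s e0.
  case/orP: (leq_total (s %% e) k') => lk.
    have /small := Vd _ _ Vk' Vm lk; have := ltn_ord k'; lia.
  have /small := Vd _ _ Vm Vk' lk; lia.
have -> : eidx D i = e by apply: gindexE.
split=> // z; split=> [Vz|/dvdzP[q ->]]; last first.
  rewrite mulrC mulrzA; exact: subgroupMz.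
have eN0 : e%:Z != 0 by rewrite eqz_nat -lt0n.
have := modz_ge0 z eN0; have := ltz_mod z eN0; have ez := divz_eq z e.
rewrite dvdzE; case em: (z %% e)%Z => [k|//] ltk _.
have Vk : V i (gam i *+ k).
  have -> : gam i *+ k = gam i *~ z - (gam i *+ e) *~ (z %/ e)%Z.
    by rewrite -[gam i *+ k]/(gam i *~ k) {1}ez em mulrzDr [_ * e%:Z]mulrC mulrzA addrC addKr.
  by apply: sV.2 => //; apply: subgroupMz.
have k0 := small k; rewrite -dvdzE; apply/dvdz_mod0P; rewrite em k0 //.
Qed.

Lemma GammaS_subgroup k : subgroup (GammaS D k).
Proof.
split=> [|x y [c [c' ->]] [d [d' ->]]].
  by exists (fun=> 0), (fun=> 0); rewrite !big1 ?addr0.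
exists (fun j => c j - d j), (fun t => c' t - d' t).
rewrite opprD addrACA -!sumrB; congr (_ + _); apply: eq_bigr => ? _; by rewrite mulrzBr.
Qed.

Lemma GammaS_value_group k x : (k <= (len D).+1)%N -> GammaS D k x -> V k x.
Proof.
move=> le [c [c' ->]]; have sV := value_group_subgroup le.
have [_ [_ [_ [Gi _ _ _]]]] := HD.
apply: subgroupD => //; apply: subgroup_sum => // j _; apply: subgroupMz => //.
  exact: value_group_Gamma.
case: k le sV j => [|k] le sV j; first by case: j.
exists (phi j); apply: (muR_phi _).1.
by rewrite -ltnS ltn_ord.
Qed.

Lemma GammaS_recr k x : GammaS D k.+1 x -> exists y z, GammaS D k y /\ x = y + gam k *~ z.
Proof.
move=> [c [c' ->]]; rewrite big_ord_recr /= addrA.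
by do 2! eexists; split; last reflexivity; exists c, c'.
Qed.

Lemma GammaS_gam k : GammaS D k.+1 (gam k).
Proof.
exists (fun=> 0), (fun t => (t == k)%:Z).
rewrite big1 // add0r big_ord_recr /= eqxx big1 ?add0r // => t _.
by rewrite (ltn_eqF (ltn_ord t)).
Qed.

Lemma GammaSW k x : GammaS D k x -> GammaS D k.+1 x.
Proof.
move=> [c [c' ->]]; exists c, (fun t => if (t < k)%N then c' t else 0).
rewrite big_ord_recr /= ltnn addr0; congr (_ + _).
by apply: eq_bigr => t _; rewrite ltn_ord.
Qed.

(** Write [x = y + z gamma_i] with [y] in [GammaS D i]. Then [(z - t) gamma_i] is a value of the
    lower level, so [e_i] divides [z - t], and [e_i gamma_i = h_i] lies in [GammaS D i]. This makes
    coefficients on the slope attainable one level down. *)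
Lemma GammaS_descend i x t : (i <= len D)%N -> GammaS D i.+1 x ->
  V i (x - gam i *+ t) -> GammaS D i (x - gam i *+ t).
Proof.
move=> le /GammaS_recr[y [z [Gy ->]]] Vt.
have -> : y + gam i *~ z - gam i *+ t = y + gam i *~ (z - t%:Z).
  by rewrite mulrzBr addrA.
apply: subgroupD => //; first exact: GammaS_subgroup.
have /(eidx_spec le).2/dvdzP[q ->] : V i (gam i *~ (z - t%:Z)).
  have := (value_group_subgroup (leqW le)).2 _ _ Vt (GammaS_value_group (leqW le) Gy).
  by rewrite mulrzBr -[y + _ - _]addrA [y + _]addrC addrK; apply.
rewrite mulrC mulrzA; apply: subgroupMz; first exact: GammaS_subgroup.
by have [_ [_ [_ [_ _ h _]]]] := HD; apply: h.
Qed.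

End Chain.

(** * Change of basis *)

Section BasisChange.
Variables (K : fieldType) (G : lmodType rat) (D : MLdata K G).
Local Notation n := (rk D).

Definition freeQ (b : 'I_n -> G) : Prop :=
  forall q : 'I_n -> rat, \sum_(j < n) q j *: b j = 0 -> forall j, q j = 0.

(** [coordG] takes coordinates from [epsilon]; freeness leaves only one choice. *)
Lemma coordG_sum (b : 'I_n -> G) (q : 'I_n -> rat) : freeQ b ->
  coordG b (\sum_(j < n) q j *: b j) =1 q.
Proof.
move=> fb j; set a := \sum_(j < n) _.
have e : a = \sum_(j < n) coordG b a j *: b j.
  exact: (epsilon_spec (inhabits (fun=> 0)) (fun r => a = \sum_(j < n) r j *: b j)
    (ex_intro _ q erefl)).
apply/eqP; rewrite -subr_eq0; apply/eqP; move: j; apply: fb.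
under eq_bigr => j _ do rewrite scalerBl.
by rewrite sumrB -e subrr.
Qed.

Lemma coordG_sumz (b : 'I_n -> G) (c : 'I_n -> int) : freeQ b ->
  coordG b (\sum_(j < n) b j *~ c j) =1 (fun j => (c j)%:~R).
Proof.
move=> fb; under [X in coordG b X]eq_bigr => j _ do rewrite -scaler_int.
exact: (coordG_sum (fun j => (c j)%:~R)).
Qed.

Section Step.
Variables (b : 'I_n -> G) (g : G).
Hypothesis fb : freeQ b.
Variable q : 'I_n -> rat.
Hypothesis eg : g = \sum_(j < n) q j *: b j.
Local Notation h k := (hN b g k).
Local Notation e k := (eN b g k).
Local Notation e' k := (e'N b g k).
Local Notation d k := (dN b g k).
Local Notation l k := (lN b g k).
Local Notation l' k := (l'N b g k).

Lemma qnE (j : 'I_n) : qn b g j = q j.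
Proof.
by rewrite /qn valK eg coordG_sum.
Qed.

Lemma eN_gt0 k : (0 < e k)%N.
Proof. by rewrite /eN absz_gt0 denq_neq0. Qed.

Lemma qn_ratio k : qn b g k = (h k)%:~R / (e k)%:R.
Proof.
rewrite /hN /eN; set x := qn _ _ _; rewrite -[LHS]divq_num_den; congr (_ / _).
by rewrite -[in LHS](gez0_abs (denq_ge0 x)).
Qed.

Lemma dN_gt0 k : (0 < d k)%N.
Proof. by rewrite gcdn_gt0 eN_gt0. Qed.

Lemma e'NS k : e' k.+1 = (e' k * (e k %/ d k))%N. Proof. by []. Qed.

(** So [e' k] is the lcm of the [e t] with [t < k], and [e' n] the least common denominator of the
    coordinates of [g]. *)
Lemma e'NS_lcm k : e' k.+1 = (e k * (e' k %/ d k))%N.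
Proof. by rewrite e'NS muln_divCA_gcd. Qed.

Lemma eN_dvd_e'N t k : (t < k)%N -> (e t %| e' k)%N.
Proof.
elim: k => // k IH; rewrite ltnS leq_eqVlt => /orP[/eqP ->|lt].
  by rewrite e'NS_lcm dvdn_mulr.
by rewrite e'NS dvdn_mulr // IH.
Qed.

(** The search [find] succeeds because [h] is prime to [e]: the gcd of [h * e'] and [e] is then [d],
    and a Bezout coefficient can be reduced modulo [e / d]. *)
Lemma lN_spec k : (d k)%:Z = (l k)%:Z * h k * (e' k)%:Z + l' k * (e k)%:Z.
Proof.
set P := fun l0 : nat => ((e k)%:Z %| (d k)%:Z - l0%:Z * h k * (e' k)%:Z)%Z.
have hasP : has P (iota 0 (e k %/ d k)).
  have [u [v uv]] := Bezoutz (h k * (e' k)%:Z) (e k)%:Z.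
  have cop : coprime `|h k| (e k) by apply: coprime_num_den.
  have gd : gcdz (h k * (e' k)%:Z) (e k)%:Z = (d k)%:Z.
    rewrite /gcdz abszM /= gcdnC Gauss_gcdr; first by [].
    by rewrite coprime_sym.
  rewrite gd in uv.
  have md : ((e k %/ d k)%N : int) != 0.
    rewrite eqz_nat -lt0n divn_gt0 ?dN_gt0 //.
    by apply: dvdn_leq; rewrite ?eN_gt0 ?dvdn_gcdl.
  have := modz_ge0 u md; have := ltz_mod u md; have eu := divz_eq u (e k %/ d k)%N.
  case er : (u %% (e k %/ d k)%N)%Z => [r|//] ltr _.
  apply/hasP; exists r; first by rewrite mem_iota /=; move: ltr; rewrite ger0_norm // ltz_nat.
  rewrite /P; have ed : (e k)%:Z = (e k %/ d k)%N%:Z * (d k)%:Z.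
    by rewrite -PoszM divnK // dvdn_gcdl.
  have ed' : (e' k)%:Z = (e' k %/ d k)%N%:Z * (d k)%:Z.
    by rewrite -PoszM divnK // dvdn_gcdr.
  (* Lowering [u] by [w (e / d)] lowers [u h e'] by [w h (e' / d) e], a multiple of [e] that the
     witness absorbs. *)
  apply/dvdzP; exists (v + (u %/ (e k %/ d k)%N)%Z * h k * (e' k %/ d k)%N%:Z).
  have -> : r%:Z = u - (u %/ (e k %/ d k)%N)%Z * (e k %/ d k)%N%:Z.
    by rewrite {1}eu er addrC addKr.
  have -> : (d k)%:Z = u * (h k * (e' k)%:Z) + v * (e k)%:Z by [].
  move: (u %/ _)%Z => w; move: ed ed'; move: (e k)%:Z (e' k)%:Z => x x' -> ->; ring.
have := nth_find 0%N hasP; rewrite nth_iota; last by move: hasP; rewrite has_find size_iota.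
rewrite add0n -[find P _]/(l k) => /dvdzP[z ez].
rewrite /l'N ez mulzK; last by rewrite eqz_nat -lt0n eN_gt0.
by rewrite -ez addrC subrK.
Qed.

(** Up to sign, the determinant of the passage from [(vecB k, vecPi k)] to [(vecP k, vecB k.+1)],
    which is therefore invertible over the integers. *)
Lemma lN_unimodular k :
  h k * (e' k %/ d k)%N%:Z * (l k)%:Z + l' k * (e k %/ d k)%N%:Z = 1.
Proof.
have dN0 : (d k)%:Z != 0 by rewrite eqz_nat -lt0n dN_gt0.
apply: (mulfI dN0); rewrite mulr1 [RHS]lN_spec.
have ed : (e k)%:Z = (e k %/ d k)%N%:Z * (d k)%:Z by rewrite -PoszM divnK // dvdn_gcdl.
have ed' : (e' k)%:Z = (e' k %/ d k)%N%:Z * (d k)%:Z by rewrite -PoszM divnK // dvdn_gcdr.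
rewrite ed ed'; ring.
Qed.

(* Exponent vectors of the monomials [phi^s * prod_j pi_j^(n_j)] in [phi = phi_i] and
   [pi_j = pi_{i,j}]: [vecB k] stands for [(phi * prod_(t < k) pi_t^(-h_t/e_t))^(e'_k)],
   [vecP j] for [pi_{i+1,j}], and [vecB n] for [Y_i]. *)
Local Notation W := (int^o * 'rV[int]_n)%type.
Definition vecPi (j : 'I_n) : W := (0, delta_mx 0 j).
Definition vecB (k : nat) : W :=
  ((e' k)%:Z, \row_(t < n) if (t < k)%N then - h t * (e' k %/ e t)%N%:Z else 0).
Definition vecP (j : 'I_n) : W := (l j)%:Z *: vecB j + l' j *: vecPi j.

Lemma vecB0 : vecB 0 = (1, 0).
Proof. by congr pair; apply/rowP => t; rewrite !mxE. Qed.

Lemma vecBS (k : 'I_n) :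
  vecB k.+1 = (e k %/ d k)%N%:Z *: vecB k - (h k * (e' k %/ d k)%N%:Z) *: vecPi k.
Proof.
rewrite /vecB /vecPi; congr pair.
  rewrite e'NS PoszM mulrC -[RHS]/(_ * _ - _ * 0); ring.
apply/rowP => t; rewrite !mxE eqxx /= ltnS leq_eqVlt.
have [/val_inj ->|ne] /= := altP (val t =P val k).
  (* At [t = k] both sides agree because [e' k.+1 / e k = e' k / d k]. *)
  rewrite -[(e' k * _)%N]/(e' k.+1) ltnn eqxx mulr0 add0r e'NS_lcm mulKn ?eN_gt0 // mulr1; ring.
have -> : (t == k) = false by apply: negbTE.
rewrite mulr0 subr0; case: ltnP => lt; last by rewrite mulr0.
rewrite -divn_mulAC ?eN_dvd_e'N // PoszM /dN; ring.
Qed.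

Lemma unimodular_step (M : lmodType int) (x y : M) (a a' c c' : int) : a * c + c' * a' = 1 ->
  x = a *: (c *: x + c' *: y) + c' *: (a' *: x - a *: y) /\
  y = a' *: (c *: x + c' *: y) - c *: (a' *: x - a *: y).
Proof.
move=> uni; rewrite !scalerDr !scalerN !scalerA; split.
  rewrite addrACA -!scalerDl [a * c'](mulrC a) -scalerBl.
  by rewrite uni subrr scale0r addr0 scale1r.
rewrite opprB [(a' * c) *: x + _]addrC addrACA -scalerDl -scalerBl.
by rewrite [c * a'](mulrC c) subrr scale0r addr0 addrC [c * a]mulrC [a' * c']mulrC uni scale1r.
Qed.

Lemma vecB_step (k : 'I_n) :
  vecB k = (h k * (e' k %/ d k)%N%:Z) *: vecP k + l' k *: vecB k.+1.
Proof. by rewrite vecBS; have [] := unimodular_step (vecB k) (vecPi k) (lN_unimodular k). Qed.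

Lemma vecPi_step (k : 'I_n) :
  vecPi k = (e k %/ d k)%N%:Z *: vecP k - (l k)%:Z *: vecB k.+1.
Proof. by rewrite vecBS; have [] := unimodular_step (vecB k) (vecPi k) (lN_unimodular k). Qed.

(** Only the coefficient of [vecB n], the exponent of [Y_i], is recorded. The exponents [C] of the
    [pi_(i+1,j)] are recovered later as coordinates of the value, since [Y_i] has value [0]. *)
Definition spanned (v : W) (z : int) : Prop :=
  exists C : 'I_n -> int, v = \sum_(j < n) C j *: vecP j + z *: vecB n.

Lemma spannedD v w x y : spanned v x -> spanned w y -> spanned (v + w) (x + y).
Proof.
move=> [C ->] [C' ->]; exists (fun j => C j + C' j).
rewrite addrACA -scalerDl -big_split /=; congr (_ + _).
by apply: eq_bigr => j _; rewrite scalerDl.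
Qed.

Lemma spannedZ c v x : spanned v x -> spanned (c *: v) (c * x).
Proof.
move=> [C ->]; exists (fun j => c * C j).
rewrite scalerDr scalerA scaler_sumr; congr (_ + _).
by apply: eq_bigr => j _; rewrite scalerA.
Qed.

Lemma spannedP j : spanned (vecP j) 0.
Proof.
exists (fun t => (t == j)%:Z); rewrite scale0r addr0 (bigD1 j) //= eqxx scale1r.
by rewrite big1 ?addr0 // => t /negbTE ->; rewrite scale0r.
Qed.

(** Descending from [vecB n], each use of [vecB_step] multiplies the exponent of [Y_i] by one
    [l' t]; at [k = 0] the product is [L'_i]. *)
Lemma spanned_vecB k : (k <= n)%N -> spanned (vecB k) (\prod_(k <= t < n) l' t).
Proof.
move=> le; rewrite -(subKn le); elim: (n - k)%N (leq_subr k n) => [_|j IH lt].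
  rewrite subn0 big_geq //; exists (fun=> 0).
  by rewrite big1 ?add0r ?scale1r // => ? _; rewrite scale0r.
have ltk : (n - j.+1 < n)%N by lia.
have eS : (n - j.+1).+1 = (n - j)%N by lia.
rewrite big_ltn // eS -[(n - j.+1)%N]/(val (Ordinal ltk)) vecB_step.
rewrite -[X in spanned _ X]add0r; apply: spannedD.
  rewrite -(mulr0 (h (Ordinal ltk) * (e' (Ordinal ltk) %/ d (Ordinal ltk))%N%:Z)).
  exact/spannedZ/spannedP.
by apply: spannedZ; rewrite /= eS; apply: IH; apply: ltnW.
Qed.

Lemma spanned_vecPi (k : 'I_n) : spanned (vecPi k) (- Lk b g k).
Proof.
rewrite vecPi_step -scaleNr -[X in spanned _ X]add0r; apply: spannedD.
  by rewrite -(mulr0 ((e k %/ d k)%N%:Z)); apply/spannedZ/spannedP.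
by rewrite /Lk -mulNr; apply: spannedZ; apply: spanned_vecB.
Qed.

Lemma spanned_all (s : int) (r : 'rV[int]_n) :
  spanned (s, r) (Lp b g * s - \sum_(j < n) r 0 j * Lk b g j).
Proof.
have -> : (s, r) = s *: vecB 0 + \sum_(j < n) r 0 j *: vecPi j :> W.
  rewrite vecB0.
  have -> : \sum_(j < n) r 0 j *: vecPi j = (0, r) :> W.
    rewrite {2}[r]row_sum_delta; elim/big_rec2: _ => // j x y _ ->.
    by rewrite -[LHS]/(r 0 j * 0 + 0, r 0 j *: delta_mx 0 j + x) mulr0 addr0.
  by rewrite -[RHS]/(s * 1 + 0, s *: 0 + r) mulr1 addr0 scaler0 add0r.
apply: spannedD.
  rewrite [Lp _ _ * s]mulrC; apply: spannedZ.
  by rewrite /Lp -(big_mkord xpredT (fun t => l' t)); apply: spanned_vecB.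
rewrite -sumrN; elim/big_rec2: _ => [|j x y _ IH].
  by exists (fun=> 0); rewrite scale0r big1 ?addr0 // => ? _; rewrite scale0r.
by apply: spannedD => //; rewrite -mulrN; apply/spannedZ/spanned_vecPi.
Qed.

Definition monG (v : W) : G := g *~ v.1 + \sum_(j < n) b j *~ v.2 0 j.

Lemma monGD v w : monG (v + w) = monG v + monG w.
Proof.
rewrite /monG addrACA -big_split /= mulrzDr; congr (_ + _).
by apply: eq_bigr => j _; rewrite mxE mulrzDr.
Qed.

Lemma monGZ c v : monG (c *: v) = monG v *~ c.
Proof.
rewrite /monG mulrzDl -mulrzA [v.1 * c]mulrC; congr (_ + _).
rewrite mulrz_suml; apply: eq_bigr => j _; by rewrite mxE mulrC mulrzA.
Qed.

(** The factors with [t < k] remove the coordinates of [g] of index below [k], because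
    [e' q_t = h_t e' / e_t]. At [k = n] nothing is left. *)
Lemma monG_vecB k : monG (vecB k) = (e' k)%:R *: \sum_(t < n | (k <= t)%N) qn b g t *: b t.
Proof.
rewrite /monG /= {1}eg -scaler_int scaler_sumr -big_split /= scaler_sumr [RHS]big_mkcond /=.
apply: eq_bigr => t _; rewrite mxE -scaler_int -qnE !scalerA -scalerDl.
case: ltnP => lt; last by rewrite addr0.
have ee : (e' k)%:R = (e' k %/ e t)%:R * (e t)%:R :> rat by rewrite -natrM divnK // eN_dvd_e'N.
rewrite qn_ratio rmorphM rmorphN /= -!pmulrn ee.
have e0 : (e t)%:R != 0 :> rat by rewrite pnatr_eq0 -lt0n eN_gt0.
have cancel (x y z : rat) : z != 0 -> x * z * (y / z) + - y * x = 0 by move=> z0; field.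
by rewrite cancel // scale0r.
Qed.

Lemma monG_vecBn : monG (vecB n) = 0.
Proof. by rewrite monG_vecB big1 ?scaler0 // => t; rewrite leqNgt ltn_ord. Qed.

Lemma monG_vecPi j : monG (vecPi j) = b j.
Proof.
rewrite /monG /= mulr0z add0r (bigD1 j) //= mxE !eqxx mulr1z big1 ?addr0 // => t ne.
by rewrite mxE (negbTE ne) andbF mulr0z.
Qed.

Lemma monG_vecP j : monG (vecP j) = nextb b g j.
Proof.
rewrite monGD !monGZ monG_vecPi monG_vecB -!scaler_int scalerA (bigD1 j) //=.
rewrite scalerDr scalerA addrAC -scalerDl; congr (_ *: _ + _).
  have e0 : (e j)%:R != 0 :> rat by rewrite pnatr_eq0 -lt0n eN_gt0.
  apply: (mulIf e0); rewrite divfK // qn_ratio.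
  have := congr1 (fun z : int => z%:~R : rat) (lN_spec j).
  rewrite rmorphD !rmorphM /= -!pmulrn => ->.
  have cancel (u v w y z : rat) : z != 0 -> (u * v * (w / z) + y) * z = u * w * v + y * z.
    by move=> z0; field.
  exact: cancel.
rewrite scaler_sumr; apply: eq_big => [m|m _]; first by rewrite andbC [RHS]ltn_neqAle eq_sym.
by rewrite scalerA qn_ratio natrM mulrA pmulrn.
Qed.

(** The matrix [Q] is lower triangular with non-zero diagonal [d / e], so the coefficients vanish
    one after the other, in increasing order of index. *)
Lemma freeQ_nextb : freeQ (nextb b g).
Proof.
move=> c ec; pose Q (m j : 'I_n) : rat := if (m == j) then (d j)%:R / (e j)%:R else
  if (j < m)%N then ((l j * e' j)%N)%:R * (h m)%:~R / (e m)%:R else 0.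
have eQ j : nextb b g j = \sum_(m < n) Q m j *: b m.
  rewrite /nextb [RHS](bigD1 j) //= {1}/Q eqxx; congr (_ + _).
  rewrite [LHS]big_mkcond [RHS]big_mkcond /=; apply: eq_bigr => m _; rewrite /Q.
  case: eqVneq => [->|ne]; first by rewrite ltnn.
  by case: ifP => //; rewrite scale0r.
have cQ m : \sum_(j < n) c j * Q m j = 0.
  move: m; apply: fb; rewrite -[RHS]ec.
  under eq_bigr => m _ do rewrite scaler_suml.
  rewrite exchange_big /=; apply: eq_bigr => j _; rewrite eQ scaler_sumr.
  by apply: eq_bigr => m _; rewrite scalerA.
have main k : forall j : 'I_n, (j < k)%N -> c j = 0.
  elim: k => // k IH j; rewrite ltnS leq_eqVlt => /orP[/eqP ejk|]; last exact: IH.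
  have := cQ j; rewrite (bigD1 j) //= {1}/Q eqxx big1 ?addr0 => [/eqP|t ne].
    have Q0 : (d j)%:R / (e j)%:R != 0 :> rat.
      by rewrite mulf_neq0 ?invr_eq0 ?pnatr_eq0 -?lt0n ?dN_gt0 ?eN_gt0.
    by rewrite mulf_eq0 (negbTE Q0) orbF => /eqP.
  have [lt|ge] := ltnP t j; first by rewrite IH ?mul0r // -ejk.
  rewrite /Q eq_sym (negbTE ne) ltnNge ge /= mulr0 //.
by move=> j; apply: (main n).
Qed.

(** * Evaluation of exponent vectors in a field *)

Section Multiplicative.
Variables (F : fieldType) (x : F) (P : 'I_n -> F).
Hypothesis (x0 : x != 0) (P0 : forall j, P j != 0).

Definition monF (v : W) : F := x ^ v.1 * \prod_(j < n) P j ^ v.2 0 j.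

Lemma monFD v w : monF (v + w) = monF v * monF w.
Proof.
rewrite /monF mulrACA -big_split /= expfzDr //; congr (_ * _).
by apply: eq_bigr => j _; rewrite mxE expfzDr.
Qed.

Lemma prod_exprz (f : 'I_n -> F) (z : int) : (\prod_(j < n) f j) ^ z = \prod_(j < n) f j ^ z.
Proof.
by apply: (big_morph (fun y => y ^ z)); [move=> u w; apply: expfzMl|apply: exp1rz].
Qed.

Lemma monFZ c v : monF (c *: v) = monF v ^ c.
Proof.
rewrite /monF expfzMl exprz_exp [v.1 * c]mulrC prod_exprz; congr (_ * _).
by apply: eq_bigr => j _; rewrite mxE exprz_exp mulrC.
Qed.

Lemma monF_sum (f : 'I_n -> W) (C : 'I_n -> int) :
  monF (\sum_(j < n) C j *: f j) = \prod_(j < n) monF (f j) ^ C j.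
Proof.
elim/big_rec2: _ => [|j y w _ <-]; last by rewrite monFD monFZ.
by rewrite /monF /= expr0z mul1r big1 // => j _; rewrite mxE expr0z.
Qed.

Lemma monF_vecPi j : monF (vecPi j) = P j.
Proof.
rewrite /monF /= expr0z mul1r (bigD1 j) //= mxE !eqxx expr1z big1 ?mulr1 // => t ne.
by rewrite mxE (negbTE ne) andbF expr0z.
Qed.

Lemma monF_vecB k : monF (vecB k) =
  x ^ (e' k) * \prod_(t < n | (t < k)%N) P t ^ (- h t * (e' k %/ e t)%N).
Proof.
rewrite /monF /= [in RHS]big_mkcond; congr (_ * _).
by apply: eq_bigr => t _; rewrite mxE; case: ifP.
Qed.

Lemma monF_vecP j : monF (vecP j) =
  x ^ (l j * e' j)%N *
  (\prod_(t < n | (t < j)%N) P t ^ (- h t * (l j)%:Z * (e' j %/ e t)%N%:Z) * P j ^ l' j).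
Proof.
rewrite monFD !monFZ monF_vecPi monF_vecB expfzMl exprz_exp mulnC PoszM -mulrA.
congr (_ * (_ * _)); rewrite ![in LHS]big_mkcond prod_exprz [in RHS]big_mkcond.
apply: eq_bigr => t _; case: ifP => _; last by rewrite exp1rz.
by rewrite exprz_exp; congr (_ ^ _); ring.
Qed.

(** One identity of exponent vectors is read twice, through [monG] and through [monF]; the same [C]
    therefore serves values and field elements. *)
Lemma span_next (s : int) (r : 'I_n -> int) : exists C : 'I_n -> int,
  g *~ s + \sum_(j < n) b j *~ r j = \sum_(j < n) nextb b g j *~ C j /\
  x ^ s * \prod_(j < n) P j ^ r j =
    \prod_(j < n) monF (vecP j) ^ C j *
    monF (vecB n) ^ (Lp b g * s - \sum_(j < n) r j * Lk b g j).
Proof.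
have [C eC] := spanned_all s (\row_j r j); exists C.
have er : \sum_(j < n) (\row_j r j) 0 j * Lk b g j = \sum_(j < n) r j * Lk b g j.
  by apply: eq_bigr => j _; rewrite mxE.
rewrite er in eC; split.
  have := congr1 monG eC; rewrite monGD monGZ monG_vecBn mul0rz addr0.
  have -> : monG (s, \row_j r j) = g *~ s + \sum_(j < n) b j *~ r j.
    by congr (_ + _); apply: eq_bigr => j _; rewrite mxE.
  move=> ->; elim/big_rec2: _ => [|j y w _ <-]; last by rewrite monGD monGZ monG_vecP.
  by rewrite /monG /= mulr0z add0r big1 // => j _; rewrite mxE mulr0z.
have := congr1 monF eC; rewrite monFD monFZ monF_sum => <-.
by congr (_ * _); apply: eq_bigr => j _; rewrite mxE.
Qed.
End Multiplicative.
End Step.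
End BasisChange.

(** * Valuations of the rational function field *)

Section ValuedField.
Variables (K : fieldType) (G : lmodType rat) (D : MLdata K G).
Hypothesis HO : order_ok D.
Local Notation vle := (vle D).
Local Notation vlt := (vlt D).
Variables (L : fieldType) (w : L -> option G).
Hypothesis Hw : is_val D w.

Lemma fvalXz x (a : G) (z : int) : w x = Some a -> w (x ^ z) = Some (a *~ z).
Proof.
move=> wx; case: z => k; first exact: (fvalX_Some Hw).
rewrite -[x ^ Negz k]/((x ^+ k.+1)^-1).
have x0 : x ^+ k.+1 != 0.
  by apply: expf_neq0; apply/eqP => e; move: wx; rewrite e (fval0 Hw).
have := fvalM Hw (x ^+ k.+1) (x ^+ k.+1)^-1.
rewrite mulfV // (fval1 Hw) (fvalX_Some Hw _ wx).
by case: (w _^-1) => //= c [] /eqP; rewrite eq_sym addrC addr_eq0 => /eqP ->.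
Qed.

Lemma fval_prod n (x : 'I_n -> L) (a : 'I_n -> G) : (forall j, w (x j) = Some (a j)) ->
  w (\prod_(j < n) x j) = Some (\sum_(j < n) a j).
Proof.
move=> wx; elim/big_rec2: _ => [|j y z _ IH]; first exact: (fval1 Hw).
by rewrite (fvalM Hw) wx IH.
Qed.

Lemma vlt0_add (a b : option G) : vle (Some 0) a -> vlt (Some 0) b -> vlt (Some 0) (vadd a b).
Proof. by move=> ha hb; rewrite -[Some 0](vadd0 (Some 0)); apply: vlt_add. Qed.

(** On the valuation ring of [w] this is equality of residue classes. *)
Definition near x y : Prop := vlt (Some 0) (w (x - y)).

Lemma near_refl x : near x x.
Proof. by rewrite /near subrr (fval0 Hw). Qed.

Lemma near_sym x y : near x y -> near y x.
Proof. by rewrite /near -opprB (fvalN Hw). Qed.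

Lemma near_trans y x z : near x y -> near y z -> near x z.
Proof. by move=> xy yz; have := fvalD_lt HO (fval_ultra Hw) xy yz; rewrite addrA subrK. Qed.

Lemma nearD x y x' y' : near x x' -> near y y' -> near (x + y) (x' + y').
Proof.
by move=> hx hy; have := fvalD_lt HO (fval_ultra Hw) hx hy; rewrite /near opprD addrACA.
Qed.

Lemma near_sum I (r : seq I) (f g : I -> L) : (forall i, near (f i) (g i)) ->
  near (\sum_(i <- r) f i) (\sum_(i <- r) g i).
Proof.
by move=> h; elim/big_rec2: _ => [|i x y _]; [apply: near_refl|apply: nearD].
Qed.

Lemma near_ge0 x y : near x y -> vle (Some 0) (w x) -> vle (Some 0) (w y).
Proof. by move=> /near_sym/(@vltW _ _ D) h wx; have := fvalD Hw h wx; rewrite subrK. Qed.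

Lemma nearM x y x' y' : vle (Some 0) (w x) -> vle (Some 0) (w y) ->
  near x x' -> near y y' -> near (x * y) (x' * y').
Proof.
move=> wx wy hx hy; have wy' := near_ge0 hy wy.
have -> : near (x * y) (x' * y') = vlt (Some 0) (w ((y - y') * x + (x - x') * y')).
  by rewrite /near; congr (vlt _ (w _)); ring.
by apply: (fvalD_lt HO (fval_ultra Hw)); rewrite (fvalM Hw) vaddC; apply: vlt0_add.
Qed.

Lemma near_val0 x y : near x y -> w x = Some 0 -> w y = Some 0.
Proof. by move=> /near_sym h wx; rewrite -wx; apply: (fvalBr_eq HO Hw); rewrite wx. Qed.

Lemma nearX x y k : vle (Some 0) (w x) -> near x y -> near (x ^+ k) (y ^+ k).
Proof.
move=> wx h; elim: k => [|k IH]; first exact: near_refl.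
rewrite !exprS; apply: nearM => //; elim: k {IH} => [|k IH].
  by rewrite expr0 (fval1 Hw) vle_refl.
by rewrite exprS (fvalM Hw) -[Some 0](vadd0 (Some 0)); apply: vle_add.
Qed.

Lemma val0_neq0 x : w x = Some 0 -> x != 0.
Proof. by move=> wx; apply/eqP => e; move: wx; rewrite e (fval0 Hw). Qed.

(** Negative powers use [1/u - 1/v = (v - u)/(u v)], where [u] and [v] have value [0]. *)
Lemma nearXz x y (z : int) : w x = Some 0 -> near x y -> near (x ^ z) (y ^ z).
Proof.
move=> wx h; have wy := near_val0 h wx.
case: z => k; first by apply: nearX; rewrite ?wx ?vle_refl.
rewrite -[x ^ _]/((x ^+ k.+1)^-1) -[y ^ _]/((y ^+ k.+1)^-1).
have hk : near (x ^+ k.+1) (y ^+ k.+1) by apply: nearX; rewrite ?wx ?vle_refl.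
have wV u : w u = Some 0 -> w (u ^- k.+1) = Some 0.
  by move=> wu; rewrite -[u ^- k.+1]/(u ^ (Negz k)) (fvalXz _ wu) mul0rz.
have u0 u : w u = Some 0 -> u ^+ k.+1 != 0 by move/val0_neq0/expf_neq0.
have -> : near (x ^- k.+1) (y ^- k.+1) =
    vlt (Some 0) (w ((y ^+ k.+1 - x ^+ k.+1) * x ^- k.+1 * y ^- k.+1)).
  rewrite /near; congr (vlt _ (w _)).
  by rewrite !mulrBl mulfV ?u0 // mul1r mulrAC mulfV ?u0 // mul1r.
rewrite !(fvalM Hw) !wV // !vadd0; exact: near_sym.
Qed.
End ValuedField.

Lemma subf_div (L : fieldType) (a b c d : L) : b != 0 -> d != 0 ->
  (a * d - c * b) / (b * d) = a / b - c / d.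
Proof. by move=> b0 d0; field; rewrite b0 d0. Qed.

(** * Extension of a valuation to the fraction field *)

Section Fractions.
Variables (K : fieldType) (G : lmodType rat) (D : MLdata K G).
Hypothesis HO : order_ok D.
Local Notation vle := (vle D).
Local Notation vlt := (vlt D).
Local Notation F := {fraction {poly K}}.
Local Notation "x %:F" := (FracField.tofrac x).
Implicit Types (X Y : fq K).

Definition fq_frac X : F := X.1%:F / X.2%:F.

Lemma fq_frac_surj (x : F) : exists X, X.2 != 0 /\ x = fq_frac X.
Proof.
elim/quotW: x => r; exists (frac r); split; first exact: denom_ratioP.
rewrite -[RHS]/(FracField.mul (FracField.tofrac _) (FracField.inv (FracField.tofrac _))) !piE.
apply/eqP; rewrite FracField.equivf_def /FracField.equivf /FracField.mulf /FracField.invf.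
by rewrite !numden_Ratio ?oner_eq0 ?mulr1 ?mul1r ?denom_ratioP // mulrC.
Qed.

Lemma fq_frac_poly p : fq_frac (fq_poly p) = p%:F.
Proof. by rewrite /fq_frac /= tofrac1 divr1. Qed.

Lemma fq_frac_mul X Y : fq_frac (fqmul X Y) = fq_frac X * fq_frac Y.
Proof. by rewrite /fq_frac /= !tofracM invfM mulrACA. Qed.

Lemma fq_frac_inv X : fq_frac (fqinv X) = (fq_frac X)^-1.
Proof. by rewrite /fq_frac /= invf_div. Qed.

Lemma fq_frac_exp X (z : int) : fq_frac (fqexp X z) = fq_frac X ^ z.
Proof.
case: z => k; rewrite /fq_frac /= !tofracXn.
  by rewrite -exprnP expr_div_n.
by rewrite -[_ ^ Negz k]/((_ ^+ k.+1)^-1) expr_div_n invf_div.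
Qed.

Lemma fq_frac_prod n (P : pred 'I_n) (X : 'I_n -> fq K) :
  fq_frac (\big[@fqmul K/fq1 K]_(j < n | P j) X j) = \prod_(j < n | P j) fq_frac (X j).
Proof.
apply: (big_morph fq_frac fq_frac_mul); by rewrite /fq_frac /= tofrac1 divr1.
Qed.

Lemma fq_frac_sub X Y : X.2 != 0 -> Y.2 != 0 ->
  fq_frac (fqsub X Y) = fq_frac X - fq_frac Y.
Proof.
move=> X0 Y0; rewrite /fq_frac /= tofracB !tofracM; apply: subf_div.
  by rewrite tofrac_eq0.
by rewrite tofrac_eq0.
Qed.

Section Extension.
Variable m : {poly K} -> option G.
Hypothesis Hm : is_val D m.

Definition frac_val (x : F) : option G :=
  fqval m (proj1_sig (constructive_indefinite_description _ (fq_frac_surj x))).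

Lemma fqval_wd X Y : X.2 != 0 -> Y.2 != 0 -> fq_frac X = fq_frac Y -> fqval m X = fqval m Y.
Proof.
move=> X0 Y0 /eqP; rewrite /fq_frac eqr_div ?tofrac_eq0 // -!tofracM tofrac_eq => /eqP e.
have := congr1 m e; rewrite !(fvalM Hm) /fqval.
have := fval_neqNone Hm X0; have := fval_neqNone Hm Y0.
case: (m X.2) (m Y.2) (m X.1) (m Y.1) => [a|] [b|] [c|] [d|] // _ _ [] h.
by congr Some; apply/eqP; rewrite subr_eq addrAC eq_sym subr_eq h addrC.
Qed.

Lemma frac_valE X : X.2 != 0 -> frac_val (fq_frac X) = fqval m X.
Proof.
move=> X0; rewrite /frac_val; case: (constructive_indefinite_description _ _) => Y [Y0 e] /=.
exact: fqval_wd.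
Qed.

Lemma frac_val_poly p : frac_val p%:F = m p.
Proof.
rewrite -fq_frac_poly frac_valE ?oner_eq0 // /fqval /= (fval1 Hm).
by case: (m p) => // a; rewrite subr0.
Qed.

Lemma fqval_shift X b : m X.2 = Some b -> fqval m X = vadd (m X.1) (Some (- b)).
Proof. by rewrite /fqval => ->; case: (m X.1). Qed.

Lemma vle_shift c a (b : G) : vle c (vadd a (Some (- b))) <-> vle (vadd c (Some b)) a.
Proof.
split=> h; have := vle_add HO h (vle_refl HO (Some _)) => h'.
  by have := h' b; rewrite -vaddA /= addNr vadd0.
by have := h' (- b); rewrite -vaddA /= subrr vadd0.
Qed.

Lemma den_Some X : X.2 != 0 -> exists b, m X.2 = Some b.
Proof. by move/(fval_neqNone Hm); case: (m X.2) => // b _; exists b. Qed.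

Lemma frac_val_is_val : is_val D frac_val.
Proof.
split=> [|x x0|x y].
- split=> [|c x y]; first by rewrite -tofrac0 frac_val_poly (fval0 Hm).
  have [X [X0 ->]] := fq_frac_surj x; have [Y [Y0 ->]] := fq_frac_surj y.
  have -> : fq_frac X + fq_frac Y = fq_frac (X.1 * Y.2 + Y.1 * X.2, X.2 * Y.2).
    by rewrite /fq_frac /= addf_div ?tofrac_eq0 // -!tofracM -tofracD.
  have XY0 : (X.1 * Y.2 + Y.1 * X.2, X.2 * Y.2).2 != 0 by rewrite mulf_neq0.
  rewrite !frac_valE //.
  have [a ea] := den_Some X0; have [b eb] := den_Some Y0.
  rewrite (fqval_shift ea) (fqval_shift eb) (@fqval_shift _ (a + b)); last first.
    by rewrite /= (fvalM Hm) ea eb.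
  rewrite !vle_shift => hX hY.
  have -> : Some (a + b) = vadd (Some a) (Some b) by [].
  apply: (fvalD Hm); rewrite (fvalM Hm) ?ea ?eb vaddA.
    by apply: (vle_add HO) => //; apply: vle_refl.
  by rewrite -vaddA [vadd (Some a) _]vaddC vaddA; apply: (vle_add HO) => //; apply: vle_refl.
- have [X [X0 e]] := fq_frac_surj x; rewrite e frac_valE //.
  have X1 : X.1 != 0.
    by apply: contra_neq x0 => X1; rewrite e /fq_frac X1 tofrac0 mul0r.
  have [a ea] := den_Some X0; rewrite (fqval_shift ea).
  by apply: vadd_neqNone => //; apply: (fval_neqNone Hm).
have [X [X0 ->]] := fq_frac_surj x; have [Y [Y0 ->]] := fq_frac_surj y.
rewrite -fq_frac_mul !frac_valE ?mulf_neq0 //.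
have [a ea] := den_Some X0; have [b eb] := den_Some Y0.
rewrite (fqval_shift ea) (fqval_shift eb) (@fqval_shift _ (a + b)) /=; last first.
  by rewrite (fvalM Hm) ea eb.
rewrite (fvalM Hm); case: (m X.1) (m Y.1) => [c|] [d|] //=.
by rewrite opprD addrACA.
Qed.

Lemma deg0_eqP X Y : X.2 != 0 -> Y.2 != 0 ->
  deg0_eq D m X Y <-> near D frac_val (fq_frac X) (fq_frac Y).
Proof.
by move=> X0 Y0; rewrite /near -fq_frac_sub // frac_valE //= mulf_neq0.
Qed.

(** If [h] inverts the denominator up to higher value, then [X.1 * h - X.1 / X.2 = (X.1 / X.2) *
    (X.2 * h - 1)] has positive value, so [X.1 * h] represents the class. *)
Lemma munit_den_poly X : munit D m X.2 -> vle (Some 0) (fqval m X) ->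
  exists p, deg0_eq D m (fq_poly p) X.
Proof.
move=> uX; have X0 := munit_neq0 HO Hm uX; case: uX => h hh; have [b eb] := den_Some X0.
rewrite (fqval_shift eb) => ge0; exists (X.1 * h).
have e2 : m (fqsub (fq_poly (X.1 * h)) X).2 = Some b by rewrite /= mul1r.
rewrite /deg0_eq (fqval_shift e2) /=.
have -> : X.1 * h * X.2 - X.1 * 1 = X.1 * (X.2 * h - 1) by ring.
by rewrite (fvalM Hm) -vaddA [vadd _ (Some (- b))]vaddC vaddA; apply: vlt0_add.
Qed.
End Extension.

(** The canonical map of graded algebras is well defined in degree zero: numerators can only gain
    value, and denominators keep theirs. *)
Lemma deg0_eq_lift (m m' : {poly K} -> option G) X Y : is_val D m -> is_val D m' ->
  X.2 != 0 -> Y.2 != 0 -> (forall f, vle (m f) (m' f)) ->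
  m' X.2 = m X.2 -> m' Y.2 = m Y.2 -> deg0_eq D m X Y -> deg0_eq D m' X Y.
Proof.
move=> Hm Hm' X0 Y0 le eX eY; have [a ea] := den_Some Hm X0; have [b eb] := den_Some Hm Y0.
have e2 : m (fqsub X Y).2 = Some (a + b) by rewrite /= (fvalM Hm) ea eb.
have e2' : m' (fqsub X Y).2 = Some (a + b) by rewrite /= (fvalM Hm') eX eY ea eb.
rewrite /deg0_eq (fqval_shift e2) (fqval_shift e2') => lt.
by apply: (vlt_le_trans HO lt); apply: (vle_add HO) => //; apply: vle_refl.
Qed.

Definition fq_unit (m : {poly K} -> option G) X : Prop := munit D m X.1 /\ munit D m X.2.

Lemma fq_unit_mul m X Y : is_val D m -> fq_unit m X -> fq_unit m Y -> fq_unit m (fqmul X Y).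
Proof. by move=> Hm [? ?] [? ?]; split; apply: munitM. Qed.

Lemma fq_unit_exp m X z : is_val D m -> fq_unit m X -> fq_unit m (fqexp X z).
Proof. by move=> Hm [? ?]; case: z => k; split; apply: munitX. Qed.

Lemma fq_unit_poly m p : is_val D m -> munit D m p -> fq_unit m (fq_poly p).
Proof. by move=> Hm up; split=> //; apply: munit1. Qed.

Lemma fq_unit_prod m n (P : pred 'I_n) (X : 'I_n -> fq K) : is_val D m ->
  (forall j, fq_unit m (X j)) -> fq_unit m (\big[@fqmul K/fq1 K]_(j < n | P j) X j).
Proof.
move=> Hm h; elim/big_rec: _ => [|j Y _]; first by split; apply: munit1.
exact: fq_unit_mul.
Qed.

Lemma fq_unit_frac_neq0 m X : is_val D m -> fq_unit m X -> fq_frac X != 0.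
Proof.
by move=> Hm [/(munit_neq0 HO Hm) X1 /(munit_neq0 HO Hm) X2]; rewrite mulf_neq0 ?invr_eq0 ?tofrac_eq0.
Qed.
End Fractions.

(** * Bases and monomials along the chain *)

Section ChainBases.
Variables (K : fieldType) (G : lmodType rat) (D : MLdata K G).
Hypothesis HD : MLchain_ok D.
Local Notation phi := (phi D).
Local Notation gam := (gam D).
Local Notation muR := (muR D).
Local Notation n := (rk D).
Local Notation iotaB := (@iotaB K G D).
Local Notation piB := (@piB K G D).
Let HO := chain_order HD.

Lemma iotaBS i : iotaB i.+1 = nextb (iotaB i) (gam i).
Proof. by rewrite /Defs.iotaB /=; case: (basis D i). Qed.

Lemma piBS i : piB i.+1 = nextpi (iotaB i) (gam i) (phi i) (piB i).
Proof. by rewrite /Defs.piB /Defs.iotaB /=; case: (basis D i). Qed.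

(** Multiplying a rational relation by the product [N] of its denominators reduces to the integral
    independence of the chain data. *)
Lemma freeQ_iota0 : freeQ (iotaB 0).
Proof.
move=> q eq j; have [_ [_ [_ [_ free _ _]]]] := HD.
pose N := \prod_(t < n) denq (q t).
pose c t := numq (q t) * \prod_(s < n | s != t) denq (q s).
have N0 : N != 0 by apply/prodf_neq0 => t _; rewrite denq_neq0.
have cE t : (c t)%:~R = N%:~R * q t.
  have -> : N = denq (q t) * \prod_(s < n | s != t) denq (q s) by rewrite /N (bigD1 t).
  rewrite /c !rmorphM /= -[X in _ = _ * X](divq_num_den (q t)).
  have d0 : (denq (q t))%:~R != 0 :> rat by rewrite intr_eq0 denq_neq0.
  have cancel (x y z : rat) : y != 0 -> x * z = y * z * (x / y) by move=> y0; field.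
  exact: cancel.
have c0 : c j = 0.
  apply: free; transitivity (N%:~R *: \sum_(t < n) q t *: iotaB 0 t); last by rewrite eq scaler0.
  rewrite scaler_sumr.
  by apply: eq_bigr => t _; rewrite -scaler_int cE scalerA.
have := cE j; rewrite c0 => /esym/eqP; rewrite mulf_eq0 intr_eq0 (negbTE N0).
by move/eqP.
Qed.

Lemma gam_coord_of_span i : (i <= len D)%N ->
  (forall x, GammaS D i x -> exists c, x = \sum_(j < n) iotaB i j *~ c j) ->
  exists q, gam i = \sum_(j < n) q j *: iotaB i j.
Proof.
move=> le span; have [_ [_ [_ [_ _ hG _]]]] := HD; have [c ec] := span _ (hG i le).
have e0 : (eidx D i)%:R != 0 :> rat by rewrite pnatr_eq0 -lt0n (eidx_spec HD le).1.
exists (fun j => (eidx D i)%:R^-1 * (c j)%:~R).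
have : (eidx D i)%:R *: gam i = \sum_(j < n) iotaB i j *~ c j by rewrite scaler_nat.
move/(congr1 (fun y => (eidx D i)%:R^-1 *: y)); rewrite scalerA mulVf // scale1r => ->.
by rewrite scaler_sumr; apply: eq_bigr => j _; rewrite -scaler_int scalerA.
Qed.

Lemma chain_bases i : (i <= (len D).+1)%N ->
  [/\ freeQ (iotaB i),
      (forall j, GammaS D i (iotaB i j))
    & forall x, GammaS D i x -> exists c, x = \sum_(j < n) iotaB i j *~ c j].
Proof.
elim: i => [_|i IH lt].
  split=> [|j|x [c [c' ->]]]; first exact: freeQ_iota0.
    exists (fun t => (t == j)%:Z), (fun=> 0); rewrite big_ord0 addr0 (bigD1 j) //= eqxx.
    by rewrite big1 ?addr0 // => t /negbTE ->.
  by exists c; rewrite big_ord0 addr0.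
have [free inG span] := IH (ltnW lt); have [q eq] := gam_coord_of_span lt span.
rewrite iotaBS; split=> [|j|x].
- exact: freeQ_nextb.
- have sG := @GammaS_subgroup _ _ D i.+1.
  rewrite -(monG_vecP free eq); apply: subgroupD => //.
    by apply: subgroupMz => //; apply: GammaS_gam.
  by apply: subgroup_sum => // t _; apply: subgroupMz => //; apply: GammaSW.
move/GammaS_recr => [y [z [/span[c ->] ->]]].
(* Only the value half of [span_next] is wanted here; its field half is instantiated with all
   variables equal to [1] in [rat]. *)
have one0 (j : 'I_n) : (1 : rat) != 0 by [].
have [C [eC _]] := span_next free eq (oner_neq0 rat) one0 z c.
by exists C; rewrite addrC eC.
Qed.

Lemma gam_coord i : (i <= len D)%N -> exists q, gam i = \sum_(j < n) q j *: iotaB i j.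
Proof. by move=> le; have [_ _ span] := chain_bases (leqW le); apply: gam_coord_of_span. Qed.

Lemma hval_coord i : (i <= len D)%N -> let b := iotaB i in let g := gam i in
  g *+ e'N b g n = \sum_(j < n) b j *~ (hN b g j * (e'N b g n %/ eN b g j)%N%:Z).
Proof.
move=> le b g; have [free _ _] := chain_bases (leqW le); have [q eq] := gam_coord le.
have := monG_vecBn free eq; rewrite /monG /= => /eqP; rewrite addr_eq0 => /eqP.
rewrite -pmulrn => ->; rewrite -sumrN; apply: eq_bigr => j _.
by rewrite mxE ltn_ord mulNr mulrNz opprK.
Qed.

(** By [hval_coord], [e' gamma_i] is an integral combination of the basis, so [e_i] divides [e'].
    Conversely [e_i gamma_i = h_i] has integral coordinates, so every denominator divides [e_i], and
    with them their lcm. *)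
Lemma eidxE i : (i <= len D)%N -> eidx D i = e'N (iotaB i) (gam i) n.
Proof.
move=> le; have [free inG span] := chain_bases (leqW le); have [q eq] := gam_coord le.
have sV := value_group_subgroup HD (leqW le); have [e0 eP] := eidx_spec HD le.
apply/eqP; rewrite eqn_dvd; apply/andP; split.
  have /eP : value_group (muR i) (gam i *~ (e'N (iotaB i) (gam i) n)%:Z).
    rewrite -pmulrn hval_coord //; apply: subgroup_sum => // j _; apply: subgroupMz => //.
    exact: (GammaS_value_group HD (leqW le)).
  by [].
have [_ [_ [_ [_ _ hG _]]]] := HD; have [c ec] := span _ (hG i le).
have dvd_e (t : 'I_n) : (eN (iotaB i) (gam i) t %| eidx D i)%N.
  have eqc : (eidx D i)%:R * qn (iotaB i) (gam i) t = (c t)%:~R.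
    rewrite (qnE free eq); rewrite -(coordG_sumz c free t) -ec /hval eq -scaler_nat scaler_sumr.
    under [X in coordG _ X]eq_bigr => j _ do rewrite scalerA.
    by rewrite (coordG_sum (fun j => (eidx D i)%:R * q j) free).
  have : ((eN (iotaB i) (gam i) t)%:Z %| (hN (iotaB i) (gam i) t) * (eidx D i)%:Z)%Z.
    apply/dvdzP; exists (c t); apply/eqP; rewrite -(eqr_int rat) !rmorphM /= -!pmulrn.
    have cancel (x y z : rat) : z != 0 -> x * y = y * (x / z) * z by move=> z0; field.
    by rewrite -eqc qn_ratio; apply/eqP/cancel; rewrite pnatr_eq0 -lt0n eN_gt0.
  rewrite Gauss_dvdzr; first by [].
  by rewrite /coprimez /gcdz /= gcdnC; apply: coprime_num_den.
have : forall k, (k <= n)%N -> (e'N (iotaB i) (gam i) k %| eidx D i)%N.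
  elim=> [_|k IH lt]; first exact: dvd1n.
  have := dvd_e (Ordinal lt); have := IH (ltnW lt); rewrite e'NS /dN /=.
  by rewrite muln_divA ?dvdn_gcdl // mulnC -/(lcmn _ _) dvdn_lcm => -> ->.
exact.
Qed.

Lemma piB_unit i k j : (i <= k <= len D)%N -> fq_unit D (muR k.+1) (piB i j).
Proof.
elim: i j => [|i IH] j /andP[le_ik le_k]; have Hm := chain_val HD le_k.
  split; last exact: munit1.
  apply: munit_const => //; apply/eqP => e.
  have [_ [[v0 _ _ _ _] [_ [_ _ _ vpi]]]] := HD.
  by have := vpi j; rewrite e (v0 0).2.
have IH' t : fq_unit D (muR k.+1) (piB i t) by apply: IH; rewrite (ltnW le_ik).
rewrite piBS; apply: fq_unit_mul => //.
  apply: fq_unit_exp => //; apply: fq_unit_poly => //.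
  by apply: (muR_phi HD _).2 => //; rewrite (ltnW le_ik).
apply: fq_unit_mul => //; last exact: fq_unit_exp.
by apply: fq_unit_prod => // t; apply: fq_unit_exp.
Qed.

Local Notation w k := (frac_val (muR k.+1)).
Local Notation Phi i := (fq_frac (fq_poly (phi i))).
Local Notation Pi i := (fun t => fq_frac (piB i t)).

Lemma Phi_neq0 i : (i <= len D)%N -> Phi i != 0.
Proof.
move=> le; rewrite fq_frac_poly tofrac_eq0; apply/eqP => e.
by have := aug_size (chain_aug HD le); rewrite e size_poly0.
Qed.

Lemma Pi_neq0 i j : (i <= len D)%N -> Pi i j != 0.
Proof.
move=> le; apply: (fq_unit_frac_neq0 HO (chain_val HD le)).
by apply: piB_unit; rewrite leqnn.
Qed.

Lemma piB_monF i j : (i <= len D)%N ->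
  fq_frac (piB i.+1 j) = monF (Phi i) (Pi i) (vecP (iotaB i) (gam i) j).
Proof.
move=> le; rewrite monF_vecP ?Phi_neq0 // => [|t]; last exact: Pi_neq0.
rewrite piBS /nextpi !fq_frac_mul !fq_frac_exp fq_frac_prod; congr (_ * (_ * _)).
by apply: eq_bigr => t _; rewrite fq_frac_exp.
Qed.

Lemma monF_val i k v : (i <= k <= len D)%N ->
  (forall j, w k (Pi i j) = Some (iotaB i j)) ->
  w k (monF (Phi i) (Pi i) v) = Some (monG (iotaB i) (gam i) v).
Proof.
move=> le wP; have [le_ik le_k] := andP le; have Hw := frac_val_is_val HO (chain_val HD le_k).
rewrite /monF (fvalM Hw) (fvalXz Hw (a := gam i)); last first.
  by rewrite fq_frac_poly (frac_val_poly (chain_val HD le_k)); apply: (muR_phi HD le).1.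
rewrite (fval_prod Hw (a := fun j => iotaB i j *~ v.2 0 j)) // => j.
by apply: (fvalXz Hw); apply: wP.
Qed.

Lemma piB_val i k j : (i <= k <= len D)%N -> w k (fq_frac (piB i j)) = Some (iotaB i j).
Proof.
elim: i j => [|i IH] j /andP[le_ik le_k].
  rewrite -[piB 0 j]/(fq_poly (pi0 j)%:P) fq_frac_poly (frac_val_poly (chain_val HD le_k)).
  rewrite (muR_const HD) //.
  by have [_ [_ [_ [_ _ _ vpi]]]] := HD; apply: vpi.
have le_i : (i <= k <= len D)%N by rewrite (ltnW le_ik).
have le := leq_trans (ltnW le_ik) le_k.
rewrite piB_monF // monF_val // => [|t]; last exact: IH.
have [free _ _] := chain_bases (leqW le); have [q eq] := gam_coord le.
by rewrite (monG_vecP free eq) iotaBS.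
Qed.

Lemma piexpE i (c : 'I_n -> int) : (i <= (len D).+1)%N ->
  fq_frac (piexp D i (\sum_(j < n) iotaB i j *~ c j)) = \prod_(j < n) fq_frac (piB i j) ^ c j.
Proof.
move=> le; have [free _ _] := chain_bases le.
rewrite /piexp fq_frac_prod; apply: eq_bigr => j _.
by rewrite fq_frac_exp (coordG_sumz c free) numq_int.
Qed.

Lemma piexp_val i k x : (i <= k <= len D)%N -> GammaS D i x ->
  w k (fq_frac (piexp D i x)) = Some x.
Proof.
move=> le; have [le_ik le_k] := andP le; have le_i := leq_trans le_ik le_k.
have [free _ span] := chain_bases (leqW le_i) => /span[c ->].
have Hw := frac_val_is_val HO (chain_val HD le_k).
rewrite piexpE ?(leqW le_i) // (fval_prod Hw (a := fun j => iotaB i j *~ c j)) // => j.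
by apply: (fvalXz Hw); apply: piB_val.
Qed.

Lemma piexp_unit i k x : (i <= k <= len D)%N -> fq_unit D (muR k.+1) (piexp D i x).
Proof.
move=> le; have [le_ik le_k] := andP le; have Hm := chain_val HD le_k.
by apply: fq_unit_prod => // j; apply: fq_unit_exp => //; apply: piB_unit.
Qed.

Lemma YfqE i : (i <= len D)%N ->
  fq_frac (Yfq D i) = monF (Phi i) (Pi i) (vecB (iotaB i) (gam i) n).
Proof.
move=> le; rewrite /Yfq fq_frac_mul fq_frac_inv /hval eidxE // hval_coord // piexpE ?leqW //.
rewrite monF_vecB; congr (_ * _); first by rewrite !fq_frac_poly tofracXn.
rewrite -prodfV; apply: eq_big => [j|j _]; first by rewrite ltn_ord.
by rewrite invr_expz mulNr.
Qed.

(** * The slope of one polynomial *)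

Section OneStep.
Variables (i : nat) (a : {poly K}) (al : G).
Hypothesis (le_i : (i <= len D)%N) (a_neq0 : a != 0).
Hypothesis (ma : muR i.+1 a = Some al) (Gal : GammaS D i.+1 al).
Local Notation s := (sI D i a).
Local Notation e := (eidx D i).
Local Notation bt t := (coefx (phi i) a t).

Lemma onl_val t : onl D i a t -> muR i (bt t) = Some (al - gam i *+ t).
Proof.
rewrite /onl -[mu D i a]/(muR i.+1 a) ma => /eqP.
by case: (muR i _) => // u [<-]; rewrite addrK.
Qed.

Lemma onl_neq0 t : onl D i a t -> bt t != 0.
Proof.
move=> o; apply/eqP => b0; have := onl_val o.
by rewrite b0 (aug_ultra (chain_aug HD le_i)).1.
Qed.

Lemma onl_GammaS t : onl D i a t -> GammaS D i (al - gam i *+ t).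
Proof.
move=> o; apply: (GammaS_descend HD) => //.
by exists (bt t); apply: onl_val.
Qed.

Lemma onl_lt t : onl D i a t -> (t < size a)%N.
Proof.
move=> o; rewrite ltnNge; apply/negP => ge; have := onl_val o.
rewrite coefx_ge ?(aug_size (chain_aug HD le_i)) //.
by rewrite (aug_ultra (chain_aug HD le_i)).1.
Qed.

Lemma onl_sI : onl D i a s.
Proof.
have [t et] := augment_attained HO (chain_aug HD le_i) a_neq0.
have ot : onl D i a t by rewrite /onl -et eqxx.
have h : has (onl D i a) (iota 0 (size a)).
  by apply/hasP; exists t => //; rewrite mem_iota onl_lt.
have := nth_find 0%N h; rewrite nth_iota //.
by move: h; rewrite has_find size_iota.
Qed.

(** The coefficients at two points of the slope differ in value by [gam i *+ (t - s)], which thus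
    lies in the lower value group; [eidx_spec] gives the divisibility. *)
Lemma onl_progression t : onl D i a t -> exists k, (k <= dR D i a)%N /\ t = (s + k * e)%N.
Proof.
move=> o; have lt := onl_lt o.
have le_st : (s <= t)%N.
  rewrite leqNgt; apply/negP => lt_ts.
  have := before_find 0%N lt_ts; rewrite nth_iota // add0n o //.
have [e0 eP] := eidx_spec HD le_i; have sV := value_group_subgroup HD (leqW le_i).
have /eP : value_group (muR i) (gam i *~ (t - s)%N).
  rewrite -pmulrn mulrnBr //.
  have -> : gam i *+ t - gam i *+ s = (al - gam i *+ s) - (al - gam i *+ t).
    by rewrite opprB [RHS]addrC addrA subrK.
  apply: sV.2; [exists (bt s)|exists (bt t)]; apply: onl_val => //; exact: onl_sI.
rewrite dvdzE /= => /dvdnP[k ek]; exists k; split; last by rewrite -ek subnKC.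
rewrite /dR leq_divRL // -ek leq_sub2r //.
exact: (@leq_bigmax_cond _ (fun x : 'I_(size a) => onl D i a x) (fun x => val x) (Ordinal lt)).
Qed.

(** Passing from [0] to [k] adds [k] times the vector of [Y_i]. As that vector has value [0], the
    factor in [pi_(i+1)] is common to all points of the slope. *)
Lemma slope_monomial k :
  Phi i ^+ (s + k * e) * fq_frac (piexp D i (al - gam i *+ (s + k * e))) =
  fq_frac (Yfq D i) ^ (epsexp D i a) * fq_frac (Yfq D i) ^+ k * fq_frac (piexp D i.+1 al).
Proof.
have [free _ span] := chain_bases (leqW le_i); have [q eq] := gam_coord le_i.
have P0 t : Pi i t != 0 by apply: Pi_neq0.
have [r er] := span _ (onl_GammaS onl_sI).
have [C [eC eM]] := span_next free eq (Phi_neq0 le_i) P0 s r.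
pose eta j := hN (iotaB i) (gam i) j * (e'N (iotaB i) (gam i) n %/ eN (iotaB i) (gam i) j)%N%:Z.
(* The [C] are the coordinates of [al] in the next basis, hence the exponents occurring in
   [piexp D i.+1 al]. *)
have eal : al = \sum_(j < n) iotaB i.+1 j *~ C j by rewrite iotaBS -eC -er -pmulrn addrC subrK.
have eu : al - gam i *+ (s + k * e) = \sum_(j < n) iotaB i j *~ (r j - k%:Z * eta j).
  rewrite mulrnDr opprD addrA er [(k * e)%N]mulnC mulrnA eidxE // hval_coord // -sumrMnl -sumrB.
  by apply: eq_bigr => j _; rewrite mulrzBr [k%:Z * _]mulrC [in RHS]mulrzA.
rewrite eu piexpE ?leqW // eal piexpE //.
have eeps : epsexp D i a = Lp (iotaB i) (gam i) * s%:Z - \sum_(j < n) r j * Lk (iotaB i) (gam i) j.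
  rewrite /epsexp /uI (onl_val onl_sI) /= er.
  have -> : Lmap (iotaB i) (gam i) (\sum_(j < n) iotaB i j *~ r j) =
      (\sum_(j < n) r j * Lk (iotaB i) (gam i) j)%:~R.
    by rewrite /Lmap rmorph_sum; apply: eq_bigr => j _; rewrite (coordG_sumz r free) -rmorphM.
  by rewrite -[s%:R]/(s%:Z%:~R) -rmorphM -rmorphB numq_int.
have -> : \prod_(j < n) fq_frac (piB i.+1 j) ^ C j =
    \prod_(j < n) monF (Phi i) (Pi i) (vecP (iotaB i) (gam i) j) ^ C j.
  by apply: eq_bigr => j _; rewrite piB_monF.
rewrite [RHS]mulrAC eeps YfqE // [X in _ = X * _]mulrC -eM.
have -> : Phi i ^ s * \prod_(j < n) fq_frac (piB i j) ^ r j = monF (Phi i) (Pi i) (s%:Z, \row_j r j).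
  by congr (_ * _); apply: eq_bigr => j _; rewrite mxE.
rewrite [monF _ _ (vecB _ _ _) ^+ k]exprnP -monFZ // -monFD ?Phi_neq0 // /monF /=.
congr (_ * _).
  by rewrite exprnP; congr (_ ^ _); rewrite PoszD PoszM eidxE.
by apply: eq_bigr => j _; rewrite !mxE ltn_ord /eta; congr (_ ^ _); ring.
Qed.
End OneStep.
End ChainBases.

(** * Residual coefficients *)

Lemma mulf_cross (L : fieldType) (x y b A B q : L) : y != 0 -> q != 0 ->
  x * q = A * B * y -> b * x / y = A * (b / q * B).
Proof.
move=> y0 q0 e; have -> : x = A * B * y / q by rewrite -e mulfK.
by field; rewrite y0 q0.
Qed.

Lemma sum_progression (M : nmodType) (P : pred nat) (X : nat -> M) s e d N : (0 < e)%N ->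
  (forall t, P t -> (t < N)%N) ->
  (forall t, P t -> exists k, (k <= d)%N /\ t = (s + k * e)%N) ->
  \sum_(k < d.+1) (if P (s + k * e)%N then X (s + k * e)%N else 0) =
  \sum_(t < N) (if P t then X t else 0).
Proof.
move=> e0 ltN prog.
rewrite -(big_mkord xpredT (fun k => if P (s + k * e)%N then X (s + k * e)%N else 0)).
rewrite -(big_mkord xpredT (fun t => if P t then X t else 0)).
rewrite -(big_map (fun k => s + k * e)%N xpredT (fun t => if P t then X t else 0)).
rewrite -(big_mkcond P) -[RHS](big_mkcond P) -big_filter -[RHS]big_filter.
apply: perm_big; apply: uniq_perm.
- rewrite filter_uniq // map_inj_uniq ?iota_uniq // => k1 k2 /addnI /eqP.
  by rewrite eqn_pmul2r // => /eqP.
- by rewrite filter_uniq ?iota_uniq.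
move=> t; rewrite !mem_filter; case o : (P t) => //; rewrite !andTb [RHS]mem_index_iota ltN //.
have [k [le_k ->]] := prog t o.
by apply/eqP; rewrite eqb_id; apply/mapP; exists k => //; rewrite mem_index_iota ltnS.
Qed.

Section Coefficients.
Variables (K : fieldType) (G : lmodType rat) (D : MLdata K G).
Hypothesis HD : MLchain_ok D.
Local Notation phi := (phi D).
Local Notation gam := (gam D).
Local Notation muR := (muR D).
Local Notation Phi i := (fq_frac (fq_poly (phi i))).
Let HO := chain_order HD.

Lemma Rcoef_den i k f j : (i <= k <= len D)%N -> munit D (muR k.+1) (Rcoef D i f j).2.
Proof.
move=> le; have [_ le_k] := andP le; have Hm := chain_val HD le_k.
rewrite /Rcoef; case: ifP => _; last exact: munit1.
by apply: munitM => //; [apply: munit1|apply: (piexp_unit HD _ le).1].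
Qed.

Lemma Yfq_den i k : (i <= k <= len D)%N -> munit D (muR k.+1) (Yfq D i).2.
Proof.
move=> le; have [_ le_k] := andP le; have Hm := chain_val HD le_k.
by apply: munitM => //; [apply: munit1|apply: (piexp_unit HD _ le).1].
Qed.

Lemma Yfq_val i k : (i <= k <= len D)%N ->
  frac_val (muR k.+1) (fq_frac (Yfq D i)) = Some 0.
Proof.
move=> le; have [le_ik le_k] := andP le; have le_i := leq_trans le_ik le_k.
have [free _ _] := chain_bases HD (leqW le_i); have [q eq] := gam_coord HD le_i.
rewrite YfqE // monF_val // => [|j]; last exact: piB_val.
by rewrite (monG_vecBn free eq).
Qed.

Section OneStep.
Variables (i : nat) (a : {poly K}) (al : G).
Hypothesis (lt_i : (i < len D)%N) (a_neq0 : a != 0).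
Hypothesis (ma : muR i.+1 a = Some al) (Gal : GammaS D i.+1 al).
Local Notation s := (sI D i a).
Local Notation e := (eidx D i).
Local Notation bt t := (coefx (phi i) a t).
Local Notation m := (muR i.+1).
Local Notation m' := (muR i.+2).
Local Notation w := (frac_val (muR i.+2)).
Local Notation Y := (fq_frac (Yfq D i)).
Local Notation R k := (fq_frac (Rcoef D i a k)).
Local Notation Q := (fq_frac (piexp D i.+1 al)).
Let le_i : (i <= len D)%N := ltnW lt_i.
Let Hm : is_val D m := chain_val HD le_i.
Let Hm' : is_val D m' := chain_val HD lt_i.
Let Hw : is_val D w := frac_val_is_val HO Hm'.
Let size_p := aug_size (chain_aug HD le_i).

(** The level [k] is left free: [k = i] serves to find a polynomial representative, [k = i.+1] to
    multiply congruences at the next level. *)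
Lemma Rcoef_val0 k : (i <= k <= len D)%N -> forall t, onl D i a (s + t * e) ->
  muR k.+1 (bt (s + t * e)) = muR i (bt (s + t * e)) ->
  frac_val (muR k.+1) (R t) = Some 0.
Proof.
move=> le t o eb; have [le_ik le_k] := andP le.
have Hwk := frac_val_is_val HO (chain_val HD le_k).
have Gu := onl_GammaS HD le_i ma Gal o; have vu := onl_val ma o.
rewrite /Rcoef o vu /= fq_frac_mul fq_frac_inv fq_frac_poly (fvalM Hwk).
rewrite (frac_val_poly (chain_val HD le_k)) eb vu -[_^-1]/(_ ^ (-1)).
by rewrite (fvalXz Hwk (a := al - gam i *+ (s + t * e))) ?piexp_val // mulrN1z /= subrr.
Qed.

(** Non-zero digits are shorter than [phi i], hence units for [mu_i], so the next step cannot change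
    their value. *)
Lemma bt_next t : bt t != 0 -> m (bt t) = muR i (bt t) /\ m' (bt t) = muR i (bt t).
Proof.
move=> b0; have sb := size_expansion_coef size_p a t.
have e1 := muR_small HD le_i sb.
have u : munit D m (bt t) by apply: (augment_small_unit HO (chain_aug HD le_i)).
by have [e2 _] := munit_next HD lt_i u; rewrite e2 e1.
Qed.

Lemma Rcoef_rep k : exists p, deg0_eq D m (fq_poly p) (Rcoef D i a k).
Proof.
have lei : (i <= i <= len D)%N by rewrite leqnn.
apply: (munit_den_poly HO Hm); first exact: Rcoef_den.
have d0 := munit_neq0 HO Hm (Rcoef_den a k lei).
have [o|no] := boolP (onl D i a (s + k * e)).
  rewrite -(frac_valE Hm) // Rcoef_val0 // ?vle_refl //.
  exact: (bt_next (onl_neq0 HD le_i ma o)).1.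
rewrite -(frac_valE Hm) // /Rcoef (negbTE no) -[fq0 K]/(fq_poly 0) fq_frac_poly tofrac0.
by rewrite (fval0 (frac_val_is_val HO Hm)).
Qed.

Lemma Rcoef_ge0 k : Defs.vle D (Some 0) (w (R k)).
Proof.
have lei : (i <= i.+1 <= len D)%N by rewrite leqnSn.
have [o|no] := boolP (onl D i a (s + k * e)).
  rewrite Rcoef_val0 // ?vle_refl //; exact: (bt_next (onl_neq0 HD le_i ma o)).2.
by rewrite /Rcoef (negbTE no) -[fq0 K]/(fq_poly 0) fq_frac_poly tofrac0 (fval0 Hw).
Qed.

Lemma online_term k : (if onl D i a (s + k * e) then
    FracField.tofrac (bt (s + k * e)) * Phi i ^+ (s + k * e) / Q else 0) =
  Y ^ epsexp D i a * (R k * Y ^+ k).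
Proof.
case: ifP => o; last first.
  by rewrite /Rcoef o -[fq0 K]/(fq_poly 0) fq_frac_poly tofrac0 mul0r mulr0.
have lei : (i <= i <= len D)%N by rewrite leqnn.
have Q0 : Q != 0 by apply: (fq_unit_frac_neq0 HO Hm'); apply: piexp_unit; rewrite ?leqnn.
have P0 : fq_frac (piexp D i (al - gam i *+ (s + k * e))) != 0.
  by apply: (fq_unit_frac_neq0 HO Hm); apply: piexp_unit.
rewrite /Rcoef o (onl_val ma o) /= fq_frac_mul fq_frac_inv [fq_frac (fq_poly (bt _))]fq_frac_poly.
have := slope_monomial HD le_i a_neq0 ma Gal k; move: Q0 P0.
move: (Phi i ^+ _) (Y ^ _) (Y ^+ k) (FracField.tofrac _) (fq_frac (piexp _ i _)) Q => x A B b q y.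
exact: mulf_cross.
Qed.

Lemma Q_val : w Q = Some al.
Proof. by rewrite (piexp_val HD) ?leqnn. Qed.

(** A term off the slope has [mu_i]-value above [al]; [muR_ge] carries this to the next valuation,
    and division by [Q] makes the term negligible. Terms on the slope are rewritten exactly. *)
Lemma near_R : near D w (FracField.tofrac a / Q)
  (Y ^ epsexp D i a * \sum_(k < (dR D i a).+1) R k * Y ^+ k).
Proof.
pose X t := FracField.tofrac (bt t) * Phi i ^+ t / Q.
have -> : FracField.tofrac a / Q = \sum_(t < size a) X t.
  rewrite {1}(expansion size_p (leqnn (size a))) rmorph_sum mulr_suml /=.
  by apply: eq_bigr => t _; rewrite /X fq_frac_poly tofracM tofracXn.
have -> : Y ^ epsexp D i a * \sum_(k < (dR D i a).+1) R k * Y ^+ k =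
    \sum_(t < size a) if onl D i a t then X t else 0.
  rewrite mulr_sumr; under eq_bigr => k _ do rewrite -online_term.
  apply: (sum_progression (P := onl D i a) X) => [|t|t].
  - exact: (eidx_spec HD le_i).1.
  - exact: (onl_lt HD le_i ma).
  - exact: (onl_progression HD le_i a_neq0 ma).
apply: (near_sum HO Hw) => t; case: ifP => o; first exact: near_refl.
rewrite /near subr0 /X; have [->|b0] := eqVneq (bt t) 0.
  by rewrite tofrac0 !mul0r (fval0 Hw).
rewrite fq_frac_poly -tofracXn -tofracM (fvalM Hw) (frac_val_poly Hm').
rewrite -[Q^-1]/(Q ^ (-1)) (fvalXz Hw _ Q_val) mulrN1z.
have lt : Defs.vlt D (Some al) (m' (bt t * phi i ^+ t)).
  apply: (vlt_le_trans HO _ (muR_ge HD _ lt_i)).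
  rewrite (fvalM Hm) (bt_next b0).1 (fvalX_Some Hm _ (muR_phi HD (k := i) _).1) ?leqnn //.
  rewrite /Defs.vlt -ma (augment_le HO (chain_aug HD le_i) a t) andTb eq_sym.
  exact: negbT o.
have := vlt_add HO (a := Some (- al)) _ (vle_refl HO _) lt.
by rewrite /= addNr vaddC; apply.
Qed.

(** In [near_R] the fractions [Y] and [R k] are replaced by polynomials chosen for [mu_i]. A
    negative [epsexp] is harmless because [Y] has value [0]. *)
Lemma step_coefficient : exists (yrep : {poly K}) (c : nat -> {poly K}),
  [/\ deg0_eq D m (fq_poly yrep) (Yfq D i),
      (forall k, (k <= dR D i a)%N -> deg0_eq D m (fq_poly (c k)) (Rcoef D i a k))
    & deg0_eq D m' (fqmul (fq_poly a) (fqinv (piexp D i.+1 al)))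
        (fqmul (fqexp (fq_poly yrep) (epsexp D i a))
               (fq_poly (\sum_(k < (dR D i a).+1) c k * yrep ^+ k)))].
Proof.
have lei : (i <= i <= len D)%N by rewrite leqnn.
have lei' : (i <= i.+1 <= len D)%N by rewrite leqnSn.
(* Congruences for [mu_i] pass to the next valuation because the denominators are units for
   [mu_i]. *)
have lift X p : munit D m X.2 -> deg0_eq D m (fq_poly p) X ->
    near D w (fq_frac X) (FracField.tofrac p).
  move=> uX dX; have X0 := munit_neq0 HO Hm uX; apply: (near_sym Hw).
  rewrite -fq_frac_poly; apply: (deg0_eqP Hm' (X := fq_poly p) (oner_neq0 _) X0).1.
  apply: (deg0_eq_lift HO Hm Hm') dX => //; first exact: oner_neq0.
  - by move=> f; apply: muR_ge.
  - by rewrite (fval1 Hm) (fval1 Hm').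
  - exact: (munit_next HD lt_i uX).1.
have [yrep hy] : exists p, deg0_eq D m (fq_poly p) (Yfq D i).
  have uY := Yfq_den lei; apply: (munit_den_poly HO Hm) => //.
  by rewrite -(frac_valE Hm) ?(munit_neq0 HO Hm uY) // Yfq_val // vle_refl.
pose c k := proj1_sig (constructive_indefinite_description _ (Rcoef_rep k)).
have hc k : deg0_eq D m (fq_poly (c k)) (Rcoef D i a k).
  by rewrite /c; case: (constructive_indefinite_description _ _).
have nY := lift _ _ (Yfq_den lei) hy; have wY := Yfq_val lei'.
have nc k := lift _ _ (Rcoef_den a k lei) (hc k).
have wy := near_val0 HO Hw nY wY.
have yrep0 : yrep != 0 by rewrite -tofrac_eq0; apply: (val0_neq0 Hw).
exists yrep, c; split=> //; apply: (deg0_eqP Hm' _ _).2.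
- by rewrite /= mul1r; apply: (munit_neq0 HO Hm'); apply: (piexp_unit HD _ _).1; rewrite leqnn.
- by rewrite /= mulr1; case: (epsexp _ _ _) => z /=; rewrite expf_neq0 ?oner_neq0.
rewrite fq_frac_mul fq_frac_inv fq_frac_poly fq_frac_mul fq_frac_exp !fq_frac_poly.
apply: (near_trans HO Hw near_R).
rewrite rmorph_sum /=; apply: (nearM HO Hw).
- by rewrite (fvalXz Hw _ wY) mul0rz vle_refl.
- apply: (fval_sum (fval_ultra Hw)) => k _; rewrite (fvalM Hw) -[Some 0](vadd0 (Some 0)).
  by apply: (vle_add HO); [apply: Rcoef_ge0|rewrite (fvalX_Some Hw _ wY) mul0rn vle_refl].
- exact: nearXz.
apply: (near_sum HO Hw) => k; rewrite tofracM tofracXn; apply: (nearM HO Hw) => //.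
- exact: Rcoef_ge0.
- by rewrite (fvalX_Some Hw _ wY) mul0rn vle_refl.
by apply: (nearX HO Hw) => //; rewrite wY vle_refl.
Qed.
End OneStep.
End Coefficients.

Section Online.
Variables (K : fieldType) (G : lmodType rat) (D : MLdata K G).
Hypothesis HD : MLchain_ok D.

Lemma onl_of_Rcoef i f j : (i <= len D)%N ->
  ~ deg0_eq D (mu D i) (Rcoef D i f j) (fq0 K) -> onl D i f (sI D i f + j * eidx D i).
Proof.
move=> le nz; apply/negPn/negP => no; apply: nz.
rewrite /Rcoef (negbTE no) /deg0_eq /fqval.
have -> : (fqsub (fq0 K) (fq0 K)).1 = 0 by rewrite /= mul0r subrr.
by rewrite -[mu D i]/(muR D i.+1) (fval0 (chain_val HD le)).
Qed.

Lemma onl_small i f t al : (i <= len D)%N -> f != 0 -> mu D i f = Some al ->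
  GammaS D i.+1 al -> onl D i f t -> let a := coefx (phi D i) f t in
  [/\ (size a < size (phi D i))%N, a != 0, muR D i a = Some (al - gam D i *+ t)
    & GammaS D i (al - gam D i *+ t)].
Proof.
move=> le f0 mf Gal o a; split; first exact: size_expansion_coef (aug_size (chain_aug HD le)) _ _.
- exact: (onl_neq0 HD le mf).
- exact: onl_val.
- exact: (onl_GammaS HD le mf Gal o).
Qed.

Lemma fq_frac_piexp0 g : fq_frac (piexp D 0 g) = FracField.tofrac (pi0exp D g)%:P.
Proof.
rewrite -[RHS]/((@FracField.tofrac {poly K} \o polyC) (pi0exp D g)) /pi0exp rmorph_prod.
rewrite /piexp fq_frac_prod; apply: eq_bigr => j _.
by rewrite fq_frac_exp fmorphXz -[piB 0 j]/(fq_poly (pi0 j)%:P) fq_frac_poly.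
Qed.

Lemma Rcoef0_residue c g : muR D 0 c%:P = Some g ->
  deg0_eq D (mu D 0) (fqmul (fq_poly c%:P) (fqinv (piexp D 0 g))) (fq_const (c / pi0exp D g)).
Proof.
move=> mc; have Hm := chain_val HD (leq0n _).
have u : fq_unit D (muR D 1) (piexp D 0 g) by apply: (piexp_unit HD).
apply: (deg0_eqP Hm _ _).2.
- by rewrite /= mul1r; apply: (munit_neq0 (chain_order HD) Hm); case: u.
- exact: oner_neq0.
rewrite fq_frac_mul fq_frac_inv -[fq_const _]/(fq_poly (c / _)%:P) !fq_frac_poly fq_frac_piexp0.
rewrite -[FracField.tofrac (c / _)%:P]/((@FracField.tofrac {poly K} \o polyC) _) fmorph_div.
exact: near_refl (frac_val_is_val (chain_order HD) Hm) _.
Qed.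
End Online.

Theorem mainTheorem17 (K : fieldType) (G : lmodType rat) (D : MLdata K G)
  (HD : MLchain_ok D)
  (f : {poly K}) (Hf0 : f != 0) (Hatt : att D (len D) f)
  (j : nat) (Hj : (j <= dR D (len D) f)%N)
  (Hcj : ~ deg0_eq D (mu D (len D)) (Rcoef D (len D) f j) (fq0 K)) :
  let r := len D in
  let a := coefx (phi D r) f (sI D r f + j * eidx D r)%N in
  (r = 0%N ->
     exists (c : K) (g : G),
       [/\ c != 0, a = c%:P, vv D c = Some g, GammaS D 0 g
         & deg0_eq D (mu D 0) (Rcoef D 0 f j) (fq_const (c / pi0exp D g))]) /\
  (forall r' : nat, r = r'.+1 ->
     att D r' a /\
     exists (yrep : {poly K}) (w : nat -> {poly K}),
       [/\ deg0_eq D (mu D r') (fq_poly yrep) (Yfq D r'),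
           (forall k, (k <= dR D r' a)%N ->
              deg0_eq D (mu D r') (fq_poly (w k)) (Rcoef D r' a k))
         & deg0_eq D (mu D r) (Rcoef D r f j)
             (fqmul (fqexp (fq_poly yrep) (epsexp D r' a))
                    (fq_poly (\sum_(k < (dR D r' a).+1) w k * yrep ^+ k)))]).
Proof.
move=> r a; have le_r : (r <= len D)%N by [].
have o : onl D r f (sI D r f + j * eidx D r) by apply: onl_of_Rcoef.
have [f0|[al [mf Gal]]] := Hatt; first by rewrite f0 eqxx in Hf0.
have [sa a0 ma Ga] := onl_small HD le_r Hf0 mf Gal o; rewrite -/a in sa a0 ma.
have eR : Rcoef D r f j =
    fqmul (fq_poly a) (fqinv (piexp D r (al - gam D r *+ (sI D r f + j * eidx D r)))).
  by rewrite /Rcoef o -/a ma.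
move: (al - _) eR ma Ga => be eR ma Ga.
split=> [r0|r' r1].
  (* [phi_0] has degree [1], so its digits are constants. *)
  have ea : a = (a`_0)%:P.
    apply: size1_polyC; move: sa; rewrite r0.
    by have [_ [_ [[[b ->] _ _] _]]] := HD; rewrite size_XaddC.
  rewrite r0 in eR ma Ga; exists a`_0, be; split=> //.
    by apply: contra_neq a0 => c0; rewrite ea c0.
  have mc : muR D 0 (a`_0)%:P = Some be by rewrite -ea.
  by have := Rcoef0_residue HD mc; rewrite -ea eR.
have lt : (r' < len D)%N by rewrite -r1.
(* With the shifted indexing, [muR D r'.+1] is [mu_(r-1)] and [GammaS D r'.+1] is [Gamma_(r-1)], so
   [ma] and [Ga] say that [a] is attainable one level down. *)
rewrite r1 in eR ma Ga *; split; first by right; exists be.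
have [y [w [hy hw h]]] := step_coefficient HD lt a0 ma Ga.
by exists y, w; split=> //; rewrite eR.
Qed.
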